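(* Let $W$ be a finite word of length $N$. Then the following three conditions are equivalent: (A') $W$ is a Sturmian palindrome; (B') $P_W(n)+P_W(N-n)=2$ for each integer $0\leq n\leq N$; (C') $W$ is a trapezoidal palindrome.
   Context: A factor of a word $W$ is a (possibly empty) contiguous block of letters of $W$; a palindrome is a word equal to its reversal (the empty word is a palindrome). $P_W(n)$ denotes the number of distinct palindromic factors of $W$ of length $n$. An infinite word $X$ is Sturmian if the number of distinct factors of $X$ of length $n$ equals $n+1$ for every $n\geq 0$; a finite word is Sturmian if it is a factor of some infinite Sturmian word (in particular every constant word $a^k$ is Sturmian). A factor $u$ of $W$ is right special if there are two distinct letters $x\neq y$ such that both $ux$ and $uy$ are factors of $W$. $R_W$ is the smallest integer $p\geq 0$ such that $W$ has no right special factor of length $p$, and $K_W$ is the length of the shortest suffix of $W$ that occurs only once in $W$ (as a factor). $W$ is trapezoidal if $|W|=R_W+K_W$. *)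

(* Defs.v *)
From mathcomp Require Import all_boot.

Set Implicit Arguments.
Unset Strict Implicit.
Unset Printing Implicit Defensive.

(* A finite word over the alphabet T is a seq T, an infinite word a function
   nat -> T.  Letters range over an arbitrary eqType; the relation "u is a
   factor of W" between finite words is infix u W. *)

Section FiniteWords.
Variable T : eqType.
Implicit Types (u W : seq T) (n p k : nat).

Definition palindrome W := W == rev W.

(* The filter discards the truncated blocks starting too close to the end. *)
Definition factors W n : seq (seq T) :=
  undup [seq u <- [seq take n (drop i W) | i <- iota 0 (size W).+1]
        | size u == n].

Lemma mem_factors W n u : (u \in factors W n) = infix u W && (size u == n).
Proof.
rewrite mem_undup mem_filter andbC; case: eqP => [<-|_]; rewrite ?andbF ?andbT //.
apply/mapP/infixP => [[i _ ->]|[s1 [s2 ->]]].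
  exists (take i W), (drop (size u) (drop i W)).
  by rewrite cat_take_drop cat_take_drop.
exists (size s1); first by rewrite mem_iota add0n /= !size_cat ltnS leq_addr.
by rewrite drop_size_cat // take_size_cat.
Qed.

Definition pal_complexity W n := count palindrome (factors W n).

(* It is enough to look for x and y among the letters of W. *)
Definition right_special W u :=
  has (fun x => has (fun y =>
    [&& x != y, infix (rcons u x) W & infix (rcons u y) W]) W) W.

Lemma right_specialP W u :
  reflect (exists x y, [/\ x <> y, infix (rcons u x) W & infix (rcons u y) W])
          (right_special W u).
Proof.
have in_W z : infix (rcons u z) W -> z \in W.
  by move/mem_infix; apply; rewrite mem_rcons mem_head.
apply: (iffP hasP) => [[x _ /hasP[y _ /and3P[/eqP ? ? ?]]]|[x [y [/eqP xy ux uy]]]].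
  by exists x, y.
exists x; first exact: in_W.
by apply/hasP; exists y; [exact: in_W | rewrite xy ux uy].
Qed.

Definition no_right_special W p := ~~ has (right_special W) (factors W p).

Fact ex_no_right_special W : exists p, no_right_special W p.
Proof.
exists (size W); apply/hasPn => u; rewrite mem_factors => /andP[_ /eqP su].
apply/right_specialP => -[x [y [_ /size_infix]]].
by rewrite size_rcons su ltnn.
Qed.

(* R_W *)
Definition right_special_bound W := ex_minn (ex_no_right_special W).

(* Occurrences are counted by starting position, so the empty word has
   (size W).+1 occurrences in W. *)
Definition occurrences u W :=
  count (fun i => prefix u (drop i W)) (iota 0 (size W).+1).

Definition unrepeated_suffix_length W k :=
  (k <= size W) && (occurrences (drop (size W - k) W) W == 1).

Fact ex_unrepeated_suffix_length W : exists k, unrepeated_suffix_length W k.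
Proof.
exists (size W); rewrite /unrepeated_suffix_length leqnn subnn drop0 /=.
rewrite /occurrences /= drop0 prefix_refl (@eq_in_count _ _ pred0) ?count_pred0 //.
move=> i; rewrite mem_iota => /andP[i_gt0 i_le] /=; apply/negbTE/negP.
move/size_prefix; rewrite size_drop leqNgt ltn_subrL i_gt0 /=.
by rewrite (leq_trans i_gt0).
Qed.

(* K_W *)
Definition shortest_unrepeated_suffix W :=
  ex_minn (ex_unrepeated_suffix_length W).

Definition trapezoidal W :=
  size W = right_special_bound W + shortest_unrepeated_suffix W.

Definition infinite_factor u (X : nat -> T) :=
  exists i, u = [seq X (i + j) | j <- iota 0 (size u)].

(* The sequence s lists the distinct factors of X of length n. *)
Definition sturmian_infinite (X : nat -> T) :=
  forall n, exists s : seq (seq T),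
    [/\ uniq s, size s = n.+1
      & forall u, u \in s <-> size u = n /\ infinite_factor u X].

End FiniteWords.

(* The infinite word may use letters outside the alphabet T of W, through an
   inclusion f of T into a larger alphabet T'.  This matters only when T has
   fewer than two letters: no infinite word over such a T is Sturmian, whereas
   every constant word (in particular the empty word) is. *)
Definition sturmian (T : eqType) (W : seq T) :=
  exists (T' : eqType) (f : T -> T') (X : nat -> T'),
    [/\ injective f, sturmian_infinite X & infinite_factor (map f W) X].

(* Main.v *)
Require Import Defs.
From mathcomp Require Import all_boot zify.

(* Let s(n) be the sum of (number of right extensions - 1) over the right special
   factors of length n of W.  Counting factors by length gives
   C(n+1) - C(n) = s(n) - [K <= n], so that W is trapezoidal iff s(n) <= 1 for
   all n, which holds for the factors of Sturmian words.

   If W is a palindrome, reversal acts on its Rauzy graphs, and connectedness of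
   the quotient graph gives P(n) + P(n+1) <= C(n+1) - C(n) + 2.  Summing over n,
   all these inequalities are equalities as soon as W has N + 1 palindromic
   factors.  This is implied by (B'), and also by (C'): if s(n) <= 1 for all n,
   complete returns to palindromes are palindromes, so the longest palindromic
   suffixes of the prefixes of W are distinct.  The equalities
   P(n) + P(n+1) = s(n) - [K <= n] + 2 then give (C') => (B') by induction on n;
   conversely, under (B') they leave only s(K) = 2 and s(K-1) = 1 as an
   alternative to N = R + K, which would make the prefix of length K repeated.

   For (C') => (A'), two right special factors 0t and 1t cannot coexist; this
   property and palindromicity are inherited by the preimage of W under
   0 -> 0, 1 -> 01, up to an exchange of letters and the removal of end letters.
   Induction on N embeds W in the image of the Fibonacci word under such
   substitutions, which preserve the Sturmian property. *)

Set Implicit Arguments.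
Unset Strict Implicit.
Unset Printing Implicit Defensive.

(** * Counting factors *)

Section Blocks.
Variable T : eqType.
Implicit Types (u v W : seq T) (i j k n : nat).

Definition block W i n := take n (drop i W).

Lemma size_block W i n : i + n <= size W -> size (block W i n) = n.
Proof. by move=> le_in; rewrite size_takel // size_drop; lia. Qed.

Lemma block_infix W i n : infix (block W i n) W.
Proof. exact: infix_trans (infix_take _ _) (infix_drop _ _). Qed.

Lemma nth_block x0 W i n k : k < n -> nth x0 (block W i n) k = nth x0 W (i + k).
Proof. by move=> lt_kn; rewrite nth_take // nth_drop. Qed.

Lemma infix_blockP u W :
  reflect (exists2 i, i + size u <= size W & u = block W i (size u)) (infix u W).
Proof.
apply: (iffP (@infixP _ _ _)) => [[p [s ->]]|[i _ ->]]; last exact/infixP/block_infix.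
exists (size p); first by rewrite !size_cat; lia.
by rewrite /block drop_size_cat // take_size_cat.
Qed.

Lemma block_rcons x0 W i n : i + n < size W ->
  block W i n.+1 = rcons (block W i n) (nth x0 W (i + n)).
Proof.
by move=> lt_in; rewrite /block (take_nth x0) ?nth_drop // size_drop; lia.
Qed.

Lemma block_cons x0 W i n : i < size W ->
  block W i n.+1 = nth x0 W i :: block W i.+1 n.
Proof. by move=> lt_i; rewrite /block (drop_nth x0). Qed.

Lemma palP W : reflect (rev W = W) (palindrome W).
Proof. by rewrite /palindrome eq_sym; apply: eqP. Qed.

Lemma infix_pal u W : palindrome W -> infix (rev u) W = infix u W.
Proof. by move=> /palP palW; rewrite -{1}palW infix_rev. Qed.

Lemma nth_pal x0 W i : palindrome W -> i < size W ->
  nth x0 W (size W - i.+1) = nth x0 W i.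
Proof. by move=> /palP palW lt_i; rewrite -{3}palW nth_rev. Qed.

Lemma factors_uniq W n : uniq (factors W n).
Proof. exact: undup_uniq. Qed.

End Blocks.

Section Counting.
Variable T : eqType.
Implicit Types (u v W : seq T) (i j k n : nat).

Definition extensions W u := count (fun x => infix (rcons u x) W) (undup W).

(** The truncated predecessor lets a factor without right extension contribute 0 instead of -1,
    which is the origin of the correction term in [complexity_step]. *)
Definition branching W n := \sum_(u <- factors W n) (extensions W u).-1.

Lemma infix_rcons_mem W u x : infix (rcons u x) W -> x \in W.
Proof. by move/mem_infix; apply; rewrite mem_rcons mem_head. Qed.

Lemma extensions_gt0P W u :
  reflect (exists x, infix (rcons u x) W) (0 < extensions W u).
Proof.
rewrite -has_count; apply: (iffP hasP) => [[x _ ux]|[x ux]]; exists x => //.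
by rewrite mem_undup (infix_rcons_mem ux).
Qed.

Lemma size_factorsS W n :
  size (factors W n.+1) = \sum_(u <- factors W n) extensions W u.
Proof.
pose E := [seq rcons u x | u <- factors W n,
                           x <- [seq x <- undup W | infix (rcons u x) W]].
transitivity (size E); last first.
  rewrite /E size_flatten /shape -map_comp sumnE big_map.
  by apply: eq_bigr => u _ /=; rewrite size_map size_filter.
apply/perm_size/uniq_perm; first exact: factors_uniq.
  apply: allpairs_uniq_dep; first exact: factors_uniq.
    by move=> u _; rewrite filter_uniq ?undup_uniq.
  by move=> [u x] [v y] _ _ /= /rcons_inj[-> ->].
move=> w; rewrite mem_factors; apply/andP/allpairsPdep => [[wW /eqP sw]|].
  case/lastP: w sw wW => // u x; rewrite size_rcons => -[su] uxW.
  exists u, x; split=> //.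
    by rewrite mem_factors su eqxx andbT (infix_trans (infix_rcons u x)).
  by rewrite mem_filter uxW mem_undup (infix_rcons_mem uxW).
case=> u [x [+ + ->]]; rewrite mem_factors mem_filter => /andP[_ /eqP su].
by case/andP=> uxW _; rewrite size_rcons su.
Qed.

Lemma right_special_extensions W u : right_special W u = (1 < extensions W u).
Proof.
apply/right_specialP/idP => [[x [y [xy ux uy]]]|]; last first.
  rewrite /extensions -size_filter.
  case E: (filter _ _) => [|x [|y s]] // _; exists x, y.
  have /(_ x) : [seq x <- undup W | infix (rcons u x) W] =i [:: x, y & s].
    by rewrite E.
  have /(_ y) : [seq x <- undup W | infix (rcons u x) W] =i [:: x, y & s].
    by rewrite E.
  rewrite !mem_filter !inE !eqxx orbT /= => /andP[-> _] /andP[-> _].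
  split=> //; have := filter_uniq (fun x => infix (rcons u x) W) (undup_uniq W).
  by rewrite E /= inE negb_or -andbA => /andP[/eqP].
have sub : {subset [:: x; y] <= [seq z <- undup W | infix (rcons u z) W]}.
  move=> z; rewrite !inE mem_filter mem_undup => /orP[] /eqP->.
    by rewrite ux (infix_rcons_mem ux).
  by rewrite uy (infix_rcons_mem uy).
rewrite /extensions -size_filter; apply: (uniq_leq_size _ sub).
by rewrite /= inE andbT; apply/eqP.
Qed.

Lemma right_special_catr W p u : right_special W (p ++ u) -> right_special W u.
Proof.
move/right_specialP=> [x [y [xy]]]; rewrite !rcons_cat => ux uy.
by apply/right_specialP; exists x, y; rewrite (catl_infix ux) (catl_infix uy).
Qed.

Lemma right_special_factor W u : right_special W u -> u \in factors W (size u).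
Proof.
move/right_specialP=> [x [y [_ ux _]]].
by rewrite mem_factors eqxx andbT (infix_trans (infix_rcons u x)).
Qed.

Lemma branching_eq0 W n : (branching W n == 0) = no_right_special W n.
Proof.
rewrite /branching sum_nat_seq_eq0 /no_right_special -all_predC.
by apply: eq_all => u /=; rewrite right_special_extensions; lia.
Qed.

Lemma no_right_specialS W n : no_right_special W n -> no_right_special W n.+1.
Proof.
move/hasPn=> noW; apply/hasPn => -[|x u].
  by rewrite mem_factors andbF.
rewrite mem_factors => /andP[_ /eqP[su]]; apply/negP => RSu.
have := @right_special_catr W [:: x] u RSu => {}RSu.
by have := noW u; rewrite -{1}su right_special_factor // RSu => /(_ isT).
Qed.

(** Suffixes of right special words are right special, so the lengths of right special factors form
    an initial segment. *)
Lemma branching_gt0 W n : (0 < branching W n) = (n < right_special_bound W).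
Proof.
rewrite lt0n branching_eq0 /right_special_bound; case: ex_minnP => R noR minR.
rewrite ltnNge; congr negb; apply/idP/idP => [/minR //|].
elim: n => [|n IH]; first by rewrite leqn0 => /eqP <-.
by rewrite leq_eqVlt ltnS => /orP[/eqP <- //|/IH /no_right_specialS].
Qed.

Lemma right_special_bound_le W : right_special_bound W <= size W.
Proof.
rewrite leqNgt -branching_gt0 -eqn0Ngt branching_eq0.
apply/hasPn => u; rewrite mem_factors => /andP[_ /eqP su].
apply/right_specialP => -[x [y [_ /size_infix]]].
by rewrite size_rcons su ltnn.
Qed.

Lemma unrepeated_suffixE W k : k <= size W ->
  unrepeated_suffix_length W k =
  ~~ has (fun i => block W i k == drop (size W - k) W) (iota 0 (size W - k)).
Proof.
move=> le_k; rewrite /unrepeated_suffix_length le_k /= /occurrences.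
set u := drop _ W; have su : size u = k by rewrite size_drop; lia.
(* Starting positions split into those before the suffix, its own, and [k] later ones that leave too
   little room. *)
have -> : (size W).+1 = (size W - k) + (1 + k) by lia.
rewrite iotaD count_cat add0n iotaD count_cat /= prefix_refl.
rewrite (@eq_in_count _ _ pred0 (iota (size W - k + 1) k)); last first.
  move=> i; rewrite mem_iota => lt_i /=; apply/negP => /size_prefix.
  by rewrite size_drop; lia.
rewrite count_pred0 !addn0 addn1 eqSS has_count -eqn0Ngt.
by congr (_ == _); apply: eq_count => i; rewrite prefixE su.
Qed.

Lemma unrepeated_suffixS W k : k < size W ->
  unrepeated_suffix_length W k -> unrepeated_suffix_length W k.+1.
Proof.
move=> lt_k; rewrite !unrepeated_suffixE ?(ltnW lt_k) //; apply: contra.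
case/hasP=> i; rewrite mem_iota /= add0n => lt_i /eqP.
have -> : size W - k = (size W - k.+1).+1 by lia.
have [x0 _] : exists x0, x0 \in W by case: (W) lt_k => // x s; exists x; rewrite mem_head.
rewrite (drop_nth x0); last by lia.
rewrite (block_cons x0); last by lia.
case=> _ eq_i; apply/hasP; exists i.+1; last by apply/eqP.
by rewrite mem_iota; lia.
Qed.

Lemma shortest_unrepeated_suffix_leE W n : n <= size W ->
  (shortest_unrepeated_suffix W <= n) = unrepeated_suffix_length W n.
Proof.
rewrite /shortest_unrepeated_suffix; case: ex_minnP => K uK minK le_n.
apply/idP/idP => [|/minK //].
elim: n le_n => [|n IH] le_n; first by rewrite leqn0 => /eqP <-.
rewrite leq_eqVlt ltnS => /orP[/eqP <- //|le_K].
by apply: unrepeated_suffixS => //; apply: IH => //; apply: ltnW.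
Qed.

Lemma shortest_unrepeated_suffix_le W : shortest_unrepeated_suffix W <= size W.
Proof.
by rewrite /shortest_unrepeated_suffix; case: ex_minnP => K /andP[].
Qed.

Lemma factors_size W : factors W (size W) = [:: W].
Proof.
apply: perm_small_eq => //; apply: uniq_perm; rewrite ?factors_uniq // => u.
rewrite mem_factors inE; apply/andP/eqP => [[/infix_blockP[i]]|->]; last first.
  by rewrite infix_refl.
move=> le_i + /eqP su; rewrite su in le_i *; have -> : i = 0 by lia.
by rewrite /block drop0 take_size.
Qed.

Lemma factors0 W : factors W 0 = [:: [::]].
Proof.
apply: perm_small_eq => //; apply: uniq_perm; rewrite ?factors_uniq // => u.
by rewrite mem_factors inE size_eq0; case: eqP => [->|]; rewrite ?infix0s ?andbF.
Qed.

(** Every occurrence that stops before the end of [W] provides an extension, so a factor has none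
    exactly when it is an unrepeated suffix. *)
Lemma extensions_eq0 W u : u \in factors W (size u) ->
  (extensions W u == 0) = (u == drop (size W - size u) W) &&
                          (shortest_unrepeated_suffix W <= size u).
Proof.
rewrite mem_factors => /andP[uW _]; have le_u := size_infix uW.
rewrite shortest_unrepeated_suffix_leE // unrepeated_suffixE //.
have ext_i i : i + size u < size W -> u = block W i (size u) -> 0 < extensions W u.
  move=> lt_i u_i; apply/extensions_gt0P.
  have [x0 _] : exists x0, x0 \in W.
    by case: (W) lt_i => // x s; exists x; rewrite mem_head.
  exists (nth x0 W (i + size u)); rewrite {1}u_i -block_rcons //.
  exact: block_infix.
apply/idP/andP => [/eqP ext0|[/eqP u_suf nrep]].
  have u_suf : u = drop (size W - size u) W.
    have /infix_blockP[i le_i u_i] := uW.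
    have i_last : i = size W - size u.
      apply/eqP; rewrite eqn_leq; apply/andP; split; first by lia.
      by rewrite leqNgt; apply/negP => lt_i; have := ext_i i _ u_i; rewrite ext0; lia.
    by rewrite {1}u_i i_last /block take_oversize // size_drop; lia.
  split; first by apply/eqP.
  rewrite -u_suf; apply/hasPn => i; rewrite mem_iota add0n /= => lt_i.
  by apply/eqP => u_i; have := ext_i i _ (esym u_i); rewrite ext0; lia.
rewrite -leqn0 leqNgt; apply/negP => /extensions_gt0P[x /infix_blockP[i]].
rewrite size_rcons => le_i eq_i; have := hasPn nrep i.
rewrite mem_iota -u_suf; case: eqP => [_ /(_ ltac:(lia)) //|[]].
rewrite (block_rcons x) in eq_i; last by lia.
by have [] := rcons_inj eq_i.
Qed.

(** A factor with [e] extensions satisfies [e + (e == 0) = 1 + e.-1], and only the suffix of length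
    [n] can have [e = 0]. *)
Lemma complexity_step W n : n <= size W ->
  size (factors W n.+1) + (shortest_unrepeated_suffix W <= n) =
  size (factors W n) + branching W n.
Proof.
move=> le_n; rewrite size_factorsS.
have -> : (shortest_unrepeated_suffix W <= n) =
          \sum_(u <- factors W n) (extensions W u == 0) :> nat.
  rewrite (eq_big_seq (fun u =>
    ((u == drop (size W - n) W) && (shortest_unrepeated_suffix W <= n)) : nat)).
    rewrite (bigD1_seq (drop (size W - n) W)) ?factors_uniq //=; last first.
      by rewrite mem_factors infix_drop size_drop subKn /=.
    by rewrite eqxx big1 ?addn0 // => u /negbTE->.
  move=> u uF; have := uF; rewrite mem_factors => /andP[_ /eqP su].
  by rewrite extensions_eq0 su.
rewrite /branching -sum1_size -!big_split /=; apply: eq_bigr => u _.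
by case: (extensions W u) => // m; rewrite addn0.
Qed.

(** Telescopes [complexity_step] between the lengths 0 and [size W], in both of which there is a
    single factor. *)
Lemma sum_branching W :
  \sum_(n < size W) branching W n + shortest_unrepeated_suffix W = size W.
Proof.
set K := shortest_unrepeated_suffix W.
have step m : m <= size W ->
    size (factors W m) + (m - K) = 1 + \sum_(n < m) branching W n.
  elim: m => [|m IH] lt_m; first by rewrite big_ord0 factors0.
  rewrite big_ord_recr /=; have := IH (ltnW lt_m).
  by have := complexity_step (ltnW lt_m); rewrite -/K; case: (leqP K m) => ? /=; lia.
have := step _ (leqnn _); rewrite factors_size /=.
by have := shortest_unrepeated_suffix_le W; rewrite -/K; lia.
Qed.

Lemma sum_branching_bound W :
  \sum_(n < right_special_bound W) branching W n + shortest_unrepeated_suffix W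
  = size W.
Proof.
have tail0 : \sum_(right_special_bound W <= n < size W) branching W n = 0.
  rewrite big_nat_cond big1 // => n /andP[/andP[le_n _] _].
  by apply/eqP; rewrite -leqn0 leqNgt branching_gt0 -leqNgt.
have := sum_branching W; rewrite -!(big_mkord predT (branching W)).
by rewrite (big_cat_nat _ (right_special_bound_le W)) //= tail0 addn0.
Qed.

Lemma bound_add_suffix_le W :
  right_special_bound W + shortest_unrepeated_suffix W <= size W.
Proof.
rewrite -[leqRHS](sum_branching_bound W) leq_add2r -[leqLHS]card_ord -sum1_card.
by apply: leq_sum => i _; rewrite branching_gt0.
Qed.

(** The terms s(n) with n < R are positive and sum to N - K, so N = R + K means that they all equal
    1. *)
Lemma trapezoidalP W : trapezoidal W <-> forall n, branching W n <= 1.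
Proof.
have sumE := sum_branching_bound W; rewrite /trapezoidal; split=> [trap n|le1].
  have sumR : \sum_(i < right_special_bound W) branching W i = right_special_bound W.
    by move: sumE; rewrite trap => /addIn.
  have [lt_n|] := ltnP n (right_special_bound W); last first.
    by rewrite leqNgt -branching_gt0; lia.
  have : \sum_(i < right_special_bound W) (branching W i).-1 = 0.
    have : \sum_(i < right_special_bound W) ((branching W i).-1 + 1) =
           \sum_(i < right_special_bound W) branching W i.
      by apply: eq_bigr => i _; have := branching_gt0 W i; rewrite ltn_ord; lia.
    rewrite big_split /= sum1_card card_ord sumR => /eqP.
    by rewrite -[X in _ == X]add0n eqn_add2r => /eqP.
  by move/eqP; rewrite sum_nat_eq0 => /forallP/(_ (Ordinal lt_n)) /=; lia.
have : \sum_(i < right_special_bound W) branching W i = right_special_bound W.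
  rewrite -[RHS]card_ord -sum1_card; apply: eq_bigr => i _.
  by have := branching_gt0 W i; rewrite ltn_ord; have := le1 i; lia.
lia.
Qed.

Lemma extensions_nil W : extensions W [::] = size (undup W).
Proof.
apply/eqP; rewrite -all_count; apply/allP => x.
by rewrite mem_undup infix1s.
Qed.

Lemma branching0 W : branching W 0 = (size (undup W)).-1.
Proof. by rewrite /branching factors0 big_seq1 extensions_nil. Qed.

Lemma branching_le1_unique W n u v : branching W n <= 1 ->
  right_special W u -> right_special W v -> size u = n -> size v = n -> u = v.
Proof.
move=> le1 RSu RSv su sv; apply/eqP/negPn/negP => uv; move: le1.
have uF := right_special_factor RSu; have vF := right_special_factor RSv.
rewrite su in uF; rewrite sv in vF.
rewrite /branching (bigD1_seq u) ?factors_uniq //=.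
rewrite -big_filter (bigD1_seq v) ?filter_uniq ?factors_uniq //=; last first.
  by rewrite mem_filter eq_sym uv.
by move: RSu RSv; rewrite !right_special_extensions; lia.
Qed.

End Counting.

(** * The palindromic complexity of a palindrome *)

Section ReversalClosure.
Variable T : eqType.
Implicit Types (u v W : seq T) (s : seq (seq T)) (i j k n : nat).

Definition rev_closure s := flatten [seq [:: u; rev u] | u <- s].

Lemma mem_rev_closure s u : (u \in rev_closure s) = (u \in s) || (rev u \in s).
Proof.
elim: s => //= v s IH; rewrite !inE IH.
have -> : (u == rev v) = (rev u == v) by rewrite -(can_eq revK) revK.
by do 2!case: (_ == _); rewrite ?orbT.
Qed.

Lemma rev_rev_closure s u : (rev u \in rev_closure s) = (u \in rev_closure s).
Proof. by rewrite !mem_rev_closure revK orbC. Qed.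

Lemma palindrome_rev u : palindrome (rev u) = palindrome u.
Proof. by rewrite /palindrome revK eq_sym. Qed.

Lemma undup_rev_closure_cons v s :
  undup (rev_closure (v :: s)) =
  if v \in rev_closure s then undup (rev_closure s)
  else if palindrome v then v :: undup (rev_closure s)
  else [:: v, rev v & undup (rev_closure s)].
Proof.
rewrite /= -/(rev_closure s) inE rev_rev_closure /palindrome.
by case: (v \in _); case: eqP => //= <-.
Qed.

(** Identify each factor with its reversal: those of length n give (C(n) + P(n)) / 2 vertices, those
    of length n + 1 give edges, and a palindromic edge is a loop. The walk along [W] connects all
    vertices, so the (C(n + 1) - P(n + 1)) / 2 other edges number at least the vertices minus
    one. *)
Lemma palindrome_complexity_le W n : palindrome W -> n < size W ->
  size (factors W n) + pal_complexity W n + pal_complexity W n.+1 <=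
  size (factors W n.+1) + 2.
Proof.
move=> palW lt_n.
(* Vertices and edges met by the walk up to position [k], latest first, so that one more step conses
   onto both lists. *)
pose Vs k := [seq block W (k - i) n | i <- iota 0 k.+1].
pose Es k := [seq block W (k - i.+1) n.+1 | i <- iota 0 k].
have shift (f : nat -> seq T) k : [seq f i | i <- iota 1 k] = [seq f i.+1 | i <- iota 0 k].
  by rewrite (iotaDl 1 0) -map_comp.
have VS k : Vs k.+1 = block W k.+1 n :: Vs k.
  by rewrite /Vs -[iota 0 k.+2]/(0 :: iota 1 k.+1) map_cons subn0 shift.
have ES k : Es k.+1 = block W k n.+1 :: Es k.
  by rewrite /Es -[iota 0 k.+1]/(0 :: iota 1 k) map_cons subn1 shift.
have memV k i : i <= k -> block W i n \in rev_closure (Vs k).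
  move=> le_ik; rewrite mem_rev_closure; apply/orP; left; apply/mapP.
  by exists (k - i); [rewrite mem_iota; lia | rewrite subKn].
have [x0 _] : exists x0, x0 \in W.
  by case: (W) lt_n => // x s; exists x; rewrite mem_head.
(* The ends of a known edge are known: reversing an edge exchanges its ends and reverses them. *)
have endsE k e : k + n <= size W -> e \in rev_closure (Es k) ->
    (take n e \in rev_closure (Vs k)) && (behead e \in rev_closure (Vs k)).
  move=> le_k eE; have /orP {}eE := etrans (esym (mem_rev_closure _ _)) eE.
  have [i lt_ik eqe] : exists2 i, i < k & e = block W i n.+1 \/ rev e = block W i n.+1.
    by case: eE => /mapP[i]; rewrite mem_iota => lt_i eqe;
      exists (k - i.+1); by [lia | left | right].
  have sb : size (block W i n) = n by rewrite size_block; lia.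
  have ends : take n (block W i n.+1) = block W i n /\
              behead (block W i n.+1) = block W i.+1 n.
    rewrite {2}(block_cons x0) ?(block_rcons x0) /=; try lia.
    by rewrite -cats1 take_size_cat.
  have := memV k i (ltnW lt_ik); have := memV k i.+1 lt_ik.
  case: ends => tk bh; rewrite -{}tk -{}bh.
  case: eqe => [-> -> -> //|eqe] bhV tkV.
  have se : size (rev e) = n.+1 by rewrite eqe size_block; lia.
  have -> : take n e = rev (behead (rev e)).
    by rewrite -[e]revK take_rev se subSnn drop1 revK.
  have -> : behead e = rev (take n (rev e)).
    by rewrite -[e]revK -drop1 drop_rev se subSS subn0 revK.
  by rewrite eqe !rev_rev_closure bhV tkV.
have closed m s : s =i factors W m -> undup (rev_closure s) =i factors W m.
  move=> sW u; rewrite mem_undup mem_rev_closure !sW !mem_factors.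
  by rewrite (infix_pal _ palW) size_rev orbb.
have VW : undup (rev_closure (Vs (size W - n))) =i factors W n.
  apply: closed => u; rewrite mem_factors; apply/mapP/andP => [[i]|].
    by rewrite mem_iota => lt_i ->; rewrite block_infix size_block //; lia.
  case=> /infix_blockP[i le_i +] /eqP su; rewrite su in le_i * => ->.
  by exists (size W - n - i); [rewrite mem_iota; lia | congr block; lia].
have EW : undup (rev_closure (Es (size W - n))) =i factors W n.+1.
  apply: closed => u; rewrite mem_factors; apply/mapP/andP => [[i]|].
    by rewrite mem_iota => lt_i ->; rewrite block_infix size_block //; lia.
  case=> /infix_blockP[i le_i +] /eqP su; rewrite su in le_i * => ->.
  by exists (size W - n - i.+1); [rewrite mem_iota; lia | congr block; lia].
have V0 : Vs 0 = [:: block W 0 n] by [].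
have E0 : Es 0 = [::] by [].
clearbody Vs Es.
have step k : k + n <= size W ->
    size (undup (rev_closure (Vs k))) + count (@palindrome T) (undup (rev_closure (Vs k))) +
    count (@palindrome T) (undup (rev_closure (Es k))) <= size (undup (rev_closure (Es k))) + 2.
  elim: k => [|k IH] le_k.
    rewrite V0 E0 undup_rev_closure_cons /=.
    by case pal0 : (palindrome (block W 0 n)) => /=; rewrite ?palindrome_rev pal0.
  have {IH} := IH (ltac:(lia)).
  rewrite VS ES (undup_rev_closure_cons (block W k.+1 n)) (undup_rev_closure_cons (block W k n.+1)).
  have eE := endsE k (block W k n.+1) (ltac:(lia)).
  have bh : behead (block W k n.+1) = block W k.+1 n.
    by rewrite (block_cons x0) //; lia.
  have tk : take n (block W k n.+1) = block W k n.
    by rewrite (block_rcons x0) -?cats1 ?take_size_cat ?size_block //; lia.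
  have := memV k k (leqnn k); move: eE; rewrite bh tk.
  (* Known vertex: a new edge adds 1 to both sides if palindromic, and 2 to the right side
     otherwise. *)
  case: (boolP (block W k.+1 n \in rev_closure (Vs k))) => vV eE uV.
    case: (block W k n.+1 \in rev_closure (Es k)) => //.
    case pe : (palindrome (block W k n.+1)) => /=.
      by rewrite pe; lia.
    by rewrite palindrome_rev pe; lia.
  (* New vertex: it adds 2 to the left side, palindromic or not. Its edge is new and not
     palindromic, the vertex not being the reversal of the preceding one, so it adds 2 to the right
     side. *)
  have -> : (block W k n.+1 \in rev_closure (Es k)) = false by apply/negP => /eE; rewrite andbF.
  have pe : palindrome (block W k n.+1) = false.
    apply/palP => pe; move: vV; rewrite -bh -pe -drop1 drop_rev size_block; last lia.
    by rewrite subn1 tk rev_rev_closure uV.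
  rewrite pe; case pv : (palindrome (block W k.+1 n)) => /=.
    by rewrite palindrome_rev pv pe; lia.
  by rewrite !palindrome_rev pv pe; lia.
have := step _ (eq_leq (subnK (ltnW lt_n))).
have pV := uniq_perm (undup_uniq _) (factors_uniq _ _) VW.
have pE := uniq_perm (undup_uniq _) (factors_uniq _ _) EW.
rewrite (perm_size pV) (perm_size pE).
by rewrite (permP pV) (permP pE).
Qed.

End ReversalClosure.

(** * Palindromes with more than N palindromic factors *)

Section Richness.
Variable T : eqType.
Implicit Types (u v W : seq T) (i j k n : nat).

Lemma pal_complexity0 W : pal_complexity W 0 = 1.
Proof. by rewrite /pal_complexity factors0. Qed.

Lemma pal_complexity_size W : pal_complexity W (size W) = palindrome W.
Proof. by rewrite /pal_complexity factors_size /= addn0. Qed.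

Lemma pal_complexity_step_le W n : palindrome W -> n < size W ->
  pal_complexity W n + pal_complexity W n.+1 + (shortest_unrepeated_suffix W <= n)
  <= branching W n + 2.
Proof.
move=> palW lt_n; have := palindrome_complexity_le palW lt_n.
by have := complexity_step (ltnW lt_n); lia.
Qed.

Lemma sum_geq_shortest W :
  \sum_(n < size W) (shortest_unrepeated_suffix W <= n) +
  shortest_unrepeated_suffix W = size W.
Proof.
set K := shortest_unrepeated_suffix W.
have le_K : K <= size W := shortest_unrepeated_suffix_le W.
have step m : \sum_(n < m) (K <= n) = m - K.
  by elim: m => [|m IH]; rewrite ?big_ord0 // big_ord_recr /= IH; lia.
by rewrite step subnK.
Qed.

(** Summing [pal_complexity_step_le] over all [n] counts each length twice except 0 and [size W].
    With that many palindromic factors the left total reaches the right one, so every inequality is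
    an equality. *)
Lemma pal_complexity_step W : palindrome W ->
  size W < \sum_(n < (size W).+1) pal_complexity W n ->
  forall n, n < size W ->
  pal_complexity W n + pal_complexity W n.+1 + (shortest_unrepeated_suffix W <= n)
  = branching W n + 2.
Proof.
move=> palW rich n lt_n.
pose l (i : 'I_(size W)) := pal_complexity W i + pal_complexity W i.+1 +
                            (shortest_unrepeated_suffix W <= i).
pose r (i : 'I_(size W)) := branching W i + 2.
have le_lr (i : 'I_(size W)) : l i <= r i by apply: pal_complexity_step_le.
have sum_rl : \sum_i r i <= \sum_i l i.
  rewrite /l /r !big_split /= sum_nat_const card_ord.
  have := sum_branching W; have := sum_geq_shortest W.
  have := rich; rewrite big_ord_recr /= pal_complexity_size palW.
  have := rich; rewrite big_ord_recl /= pal_complexity0.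
  rewrite /bump /=; set A := bigop _ _ _; set B := bigop _ _ _.
  set C := bigop _ _ _; set D := bigop _ _ _.
  by move=> *; lia.
have : \sum_i (r i - l i) = 0.
  by rewrite sumnB //; apply/eqP; rewrite subn_eq0.
move/eqP; rewrite sum_nat_eq0 => /forallP/(_ (Ordinal lt_n)) /=.
by have := le_lr (Ordinal lt_n); rewrite /l /r /=; lia.
Qed.

End Richness.

Ltac size_lia :=
  repeat match goal with
  | H : is_true (infix _ _) |- _ => clear H
  | H : is_true (right_special _ _) |- _ => clear H
  | H : is_true (palindrome _) |- _ => clear H
  | H : is_true (_ \in _) |- _ => clear H
  | H : _ <> _ |- _ => clear H
  | H : @eq (seq _) _ _ |- _ => clear H
  | H : @eq (Equality.sort ?T) _ _ |- _ => clear H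
  | H : forall _, _ |- _ => clear H
  | x := _ |- _ => clear x
  end; lia.

(** * Complete returns to palindromes in a trapezoidal palindrome *)

Section TrapezoidalRich.
Variables (T : eqType) (W : seq T).
Implicit Types (u v : seq T) (i j k n : nat).
Hypothesis palW : palindrome W.
Hypothesis branching_le1 : forall n, branching W n <= 1.

Lemma right_special_unique u v :
  right_special W u -> right_special W v -> size u = size v -> u = v.
Proof. by move=> RSu RSv su; exact: (branching_le1_unique (branching_le1 _) RSu RSv su). Qed.

Lemma two_letters x y z : x \in W -> y \in W -> z \in W ->
  x <> z -> y <> z -> x = y.
Proof.
move=> xW yW zW /eqP xz /eqP yz; apply/eqP/negPn/negP => xy.
have := branching_le1 0; rewrite branching0.
suff : 3 <= size (undup W) by size_lia.
apply: (@uniq_leq_size _ [:: x; y; z]); first by rewrite /= !inE negb_or xy xz yz.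
by move=> t; rewrite mem_undup !inE => /or3P[] /eqP->.
Qed.

Lemma right_special_pair u x y : x <> y ->
  infix (rcons u x) W -> infix (rcons u y) W -> right_special W u.
Proof. by move=> xy ux uy; apply/right_specialP; exists x, y. Qed.

Lemma right_special_left u x y : x <> y ->
  infix (x :: u) W -> infix (y :: u) W -> right_special W (rev u).
Proof.
move=> xy ux uy; apply: (right_special_pair xy); rewrite -rev_cons.
  by rewrite infix_pal.
by rewrite infix_pal.
Qed.

(* If e t is the block at i, going down from n.+1 to n keeps every property:
   an inner occurrence of t or rev t would make t a palindrome extended in
   four ways into x t y, hence two right special words of the same length. *)
Lemma no_skew_return x0 n i j :
  i < j -> j + n <= size W -> block W j n = rev (block W i n) ->
  (forall k, i < k < j -> block W k n <> block W i n /\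
                          block W k n <> rev (block W i n)) ->
  nth x0 W (i + n) = nth x0 W j.-1.
Proof.
elim: n i j => [|n IH] i j lt_ij le_j rev_ij inner.
  (* The empty word occurs at every position, so no position lies between [i] and [j]. *)
  rewrite addn0; case: (ltngtP j i.+1) => [|lt_j|->//]; first by size_lia.
  by have [] := inner i.+1 ltac:(size_lia); rewrite /block !take0.
apply/eqP/negPn/negP => /eqP cd.
set c := nth x0 W (i + n.+1) in cd; set d := nth x0 W j.-1 in cd.
set e := nth x0 W i; pose t := block W i.+1 n.
have et : block W i n.+1 = e :: t by rewrite (block_cons x0) //; size_lia.
have st : size t = n by rewrite size_block; size_lia.
have [rt je] : block W j n = rev t /\ nth x0 W (j + n) = e.
  have : block W j n.+1 = rcons (rev t) e by rewrite rev_ij et rev_cons.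
  by rewrite (block_rcons x0) => [/rcons_inj[]|]; last size_lia.
have tc : infix (rcons t c) W.
  by rewrite /t /c addnS -addSn -block_rcons ?block_infix //; size_lia.
have etc : infix (e :: rcons t c) W.
  rewrite -rcons_cons -et /c -block_rcons ?block_infix //; size_lia.
have etd : infix (e :: rcons t d) W.
  rewrite -(infix_pal _ palW) rev_cons rev_rcons /= -rev_cons -et -rev_ij.
  have -> : block W j n.+1 = block W j.-1.+1 n.+1 by congr block; size_lia.
  by rewrite /d -block_cons ?block_infix //; size_lia.
have td : infix (rcons t d) W by apply: infix_trans etd; apply: infix_cons.
have RSt := right_special_pair cd tc td.
have tE : infix (rcons (rev t) e) W.
  by rewrite -rt -je -block_rcons ?block_infix //; size_lia.
(* If [j = i.+1], then [c] and [d] are both the letter [e]. *)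
have lt_ij1 : i.+1 < j.
  rewrite ltn_neqAle lt_ij andbT; apply/eqP => jE; apply: cd.
  by rewrite /c /d -jE /= addnS -addSn jE je.
have eW : e \in W by apply: mem_nth; size_lia.
have cW : c \in W by apply: mem_nth; size_lia.
have dW : d \in W by apply: mem_nth; size_lia.
have aux k : i.+1 < k < j -> block W k n = t -> False.
  move=> lt_k kt; pose e1 := nth x0 W k.-1; pose f := nth x0 W (k + n).
  have e1W : e1 \in W by apply: mem_nth; size_lia.
  have fW : f \in W by apply: mem_nth; size_lia.
  have e1t : block W k.-1 n.+1 = e1 :: t.
    by rewrite (block_cons x0) ?prednK ?kt //; size_lia.
  have tf : block W k n.+1 = rcons t f by rewrite (block_rcons x0) ?kt //; size_lia.
  have ne1 : e1 <> e.
    by move=> e1e; case: (inner k.-1 ltac:(size_lia)) => + _; rewrite e1t et e1e.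
  have e1tW : infix (e1 :: t) W by rewrite -e1t block_infix.
  have etW : infix (e :: t) W by rewrite -et block_infix.
  have rt_t : rev t = t.
    apply: right_special_unique => //; last exact: size_rev.
    exact: right_special_left ne1 e1tW etW.
  have nf : f <> e.
    move=> fe; case: (inner k ltac:(size_lia)) => _.
    by rewrite tf et fe rev_cons rt_t.
  have fe1 : f = e1 by apply: (two_letters fW e1W eW).
  have e1te1 : infix (rcons (e1 :: t) e1) W.
    have -> : rcons (e1 :: t) e1 = block W k.-1 n.+2; last exact: block_infix.
    rewrite (block_cons x0) ?prednK ?tf ?fe1 //; size_lia.
  (* As [c] and [d] differ, one of them is [e1], the only letter of [W] other than [e]. *)
  have ete1 : infix (e :: rcons t e1) W.
    case: (eqVneq c e) => [ce|/eqP ce].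
      suff <- : d = e1 by [].
      by apply: (two_letters dW e1W eW) => // de; apply: cd; rewrite ce de.
    by suff <- : c = e1 by []; apply: (two_letters cW e1W eW).
  have e1te : infix (rcons (e1 :: t) e) W.
    by rewrite -(infix_pal _ palW) rev_rcons rev_cons rt_t.
  have RSe := @right_special_pair (e :: t) _ _ cd etc etd.
  have RSe1 := right_special_pair ne1 e1te1 e1te.
  by have [] := right_special_unique RSe1 RSe erefl.
apply/cd; rewrite /c addnS -addSn; apply: IH => //; first size_lia.
move=> k lt_k; split; first exact: aux.
(* An inner [rev t] is not followed by [e], while the one at [j] is; so [rev t] is right special and
   equals [t], the case just excluded. *)
move=> krt; apply: (aux k) => //; rewrite krt.
pose f := nth x0 W (k + n).
have rtf : block W k n.+1 = rcons (rev t) f by rewrite (block_rcons x0) ?krt //; size_lia.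
have nf : f <> e.
  by move=> fe; case: (inner k ltac:(size_lia)) => _; rewrite rtf et fe rev_cons.
have rtfW : infix (rcons (rev t) f) W by rewrite -rtf block_infix.
apply: right_special_unique => //; last exact: size_rev.
exact: right_special_pair nf rtfW tE.
Qed.

(** If [n] is the first mismatch between the block and its reversal, the prefix of length [n] and
    its mirror image at the other end fall under [no_skew_return], which makes the two mismatched
    letters equal. *)
Lemma complete_return_pal i j m : i < j -> j + m <= size W ->
  block W i m = block W j m -> palindrome (block W i m) ->
  (forall k, i < k < j -> block W k m <> block W i m) ->
  palindrome (block W i (j + m - i)).
Proof.
move=> lt_ij le_j ij_eq pal_m inner; apply/negPn/negP => npal.
have [x0 _] : exists x0, x0 \in W.
  by case: (W) le_j => [|x s]; [rewrite leqn0; size_lia | exists x; rewrite mem_head].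
pose L := j + m - i; pose w := nth x0 W.
have su : size (block W i L) = L by rewrite size_block; size_lia.
have ex_bad : exists q, (q < L) && (w (i + q) != w (i + (L - q.+1))).
  have [/hasP[q]|/hasPn noq] :=
      boolP (has (fun q => w (i + q) != w (i + (L - q.+1))) (iota 0 L)).
    by rewrite mem_iota => lt_q neq_q; exists q; rewrite neq_q andbT; size_lia.
  case/negP: npal; apply/palP/(@eq_from_nth _ x0); first exact: size_rev.
  move=> q; rewrite size_rev su => lt_q; rewrite nth_rev su // !nth_block //; last by size_lia.
  by have /negPn/eqP := noq q ltac:(rewrite mem_iota; size_lia); rewrite /w => ->.
case: (ex_minnP ex_bad) => n /andP[lt_n /eqP neq_n] min_n.
have mirror q : q < n -> w (i + q) = w (i + (L - q.+1)).
  move=> lt_q; apply/eqP/negPn/negP => neq_q.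
  by have := min_n q; rewrite neq_q andbT; size_lia.
(* Mismatches are placed symmetrically, so the first one lies strictly in the left half. *)
have le_n2 : n.*2.+1 < L.
  have neq : n != L - n.+1 by apply/eqP => nE; apply: neq_n; rewrite {1}nE.
  have := min_n (L - n.+1); rewrite (_ : L - (L - n.+1).+1 = n); last by size_lia.
  by rewrite eq_sym; move/eqP: neq_n => -> /(_ ltac:(size_lia)); size_lia.
(* Both ends are the same palindrome of length [m], so there is no mismatch inside them. *)
have le_mn : m <= n.
  rewrite leqNgt; apply/negP => lt_nm; apply: neq_n.
  have -> : i + (L - n.+1) = j + (m - n.+1) by size_lia.
  have lt_m : m - n.+1 < m by size_lia.
  rewrite /w -(nth_block x0 W i lt_nm) -(nth_block x0 W j lt_m) -ij_eq.
  rewrite -[in RHS](palP _ pal_m) nth_rev size_block; try size_lia.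
  by congr nth; size_lia.
have jE : (j + m - n).-1 = i + (L - n.+1) by size_lia.
apply: neq_n; rewrite -jE; apply: no_skew_return; try size_lia.
  apply: (@eq_from_nth _ x0) => [|q]; first by rewrite size_rev !size_block //; size_lia.
  rewrite size_block; last by size_lia.
  move=> lt_q; rewrite nth_rev size_block ?nth_block; try size_lia.
  rewrite -/(w _) -/(w _) mirror; last by size_lia.
  by congr w; size_lia.
(* An inner occurrence of the prefix of length [n] begins with the palindrome of length [m], and one
   of its reversal ends with it; either way the palindrome recurs between [i] and [j]. *)
have tk q : block W q m = take m (block W q n) by rewrite /block take_takel.
move=> k lt_k; split=> kn.
  case: (inner k ltac:(size_lia)).
  by rewrite !tk kn.
have size_i : size (block W i n) = n by rewrite size_block; size_lia.
case: (inner (k + n - m) ltac:(size_lia)).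
have <- : drop (n - m) (block W k n) = block W (k + n - m) m.
  rewrite /block (_ : take n _ = take (m + (n - m)) (drop k W));
    last by rewrite subnKC.
  by rewrite -take_drop drop_drop; congr (take _ (drop _ _)); size_lia.
rewrite kn drop_rev size_i subKn // -tk.
exact/palP.
Qed.

(** The least [i] starts the longest palindromic suffix of the prefix of length [k]. The last of its
    earlier occurrences would bound a complete return, hence a longer palindromic suffix. *)
Lemma longest_pal_suffix k : k <= size W ->
  exists2 i, i <= k & palindrome (block W i (k - i)) /\
    forall j, j + (k - i) < k -> block W j (k - i) <> block W i (k - i).
Proof.
move=> le_k; pose P i := (i <= k) && palindrome (block W i (k - i)).
have exP : exists i, P i by exists k; rewrite /P leqnn subnn /block take0.
case: (ex_minnP exP) => i /andP[le_i pal_i] min_i; exists i => //; split=> // j lt_j ji.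
pose Q j := (j + (k - i) < k) && (block W j (k - i) == block W i (k - i)).
have exQ : exists j, Q j by exists j; rewrite /Q lt_j ji eqxx.
have ubQ q : Q q -> q <= k by case/andP; size_lia.
case: (ex_maxnP exQ ubQ) => q /andP[lt_q /eqP qi] max_q.
suff : P q by move/min_i; size_lia.
rewrite /P; apply/andP; split; first by size_lia.
have -> : k - q = i + (k - i) - q by size_lia.
apply: complete_return_pal; rewrite ?qi //; try size_lia.
move=> r lt_r ri; have := max_q r; rewrite /Q ri eqxx andbT; size_lia.
Qed.

(** Each of the [size W + 1] prefixes, the empty one included, contributes its longest palindromic
    suffix, which has not occurred before. *)
Lemma sum_pal_complexity_gt : size W < \sum_(n < (size W).+1) pal_complexity W n.
Proof.
have [s [size_s uniq_s s_pal]] : exists s, [/\ size s = (size W).+1, uniq s &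
    forall u, u \in s -> palindrome u /\ infix u W].
  suff: forall m, m <= (size W).+1 -> exists s, [/\ size s = m, uniq s &
      forall u, u \in s -> palindrome u /\
        exists2 i, i + size u < m & u = block W i (size u)].
    case/(_ (size W).+1 (leqnn _)) => s [? ? sP]; exists s; split=> // u /sP[pal_u [i _ uE]].
    by split=> //; rewrite uE; apply: block_infix.
  elim=> [|k IH] lt_k; first by exists [::].
  have [s [size_s uniq_s s_pal]] := IH (ltnW lt_k).
  have [i le_i [pal_i first_i]] := @longest_pal_suffix k lt_k.
  have si : size (block W i (k - i)) = k - i by rewrite size_block; size_lia.
  exists (block W i (k - i) :: s); split=> /=; first by rewrite size_s.
    rewrite uniq_s andbT; apply/negP => /s_pal[_ [j]]; rewrite si => lt_j ji.
    exact: (first_i j lt_j).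
  move=> u; rewrite inE => /orP[/eqP-> | /s_pal[pal_u [j lt_j uj]]].
    by split=> //; exists i; rewrite ?si //; size_lia.
  by split=> //; exists j => //; size_lia.
pose t := flatten [seq filter (@palindrome T) (factors W n) | n <- iota 0 (size W).+1].
have -> : \sum_(n < (size W).+1) pal_complexity W n = size t.
  rewrite size_flatten /shape -map_comp sumnE big_map -(big_mkord predT) /index_iota subn0.
  by apply: eq_bigr => n _; rewrite /= size_filter.
rewrite -size_s; apply: (uniq_leq_size uniq_s) => u /s_pal[pal_u uW].
apply/flatten_mapP; exists (size u); first by rewrite mem_iota ltnS size_infix.
by rewrite mem_filter pal_u mem_factors uW /=.
Qed.

(** Here s(n) is the indicator of n < R, and N = R + K makes n < R equivalent to K <= N - n - 1.
    Hence the indicators cancel in the sum of the equalities at n and N - n - 1, which carries the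
    claim from n to n + 1. *)
Lemma trapezoidal_pal_complexity n : n <= size W ->
  pal_complexity W n + pal_complexity W (size W - n) = 2.
Proof.
have trap : trapezoidal W by apply/trapezoidalP.
have step := pal_complexity_step palW sum_pal_complexity_gt.
have branchE k : branching W k = (k < right_special_bound W).
  by have := branching_gt0 W k; have := branching_le1 k; size_lia.
elim: n => [|n IH] lt_n.
  by rewrite subn0 pal_complexity0 pal_complexity_size palW.
have {IH} := IH (ltnW lt_n).
have := step _ lt_n; have := step (size W - n.+1) ltac:(size_lia).
rewrite !branchE (_ : (size W - n.+1).+1 = size W - n); last by size_lia.
by move: trap; rewrite /trapezoidal; size_lia.
Qed.

End TrapezoidalRich.

(** * From the palindrome counts to trapezoidality *)

Section FromPalindromeCounts.
Variables (T : eqType) (W : seq T).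
Implicit Types (u v : seq T) (i j k n : nat).
Hypothesis pal_sum : forall n, n <= size W ->
  pal_complexity W n + pal_complexity W (size W - n) = 2.

Local Notation R := (right_special_bound W).
Local Notation K := (shortest_unrepeated_suffix W).

Lemma pal_sum_palindrome : palindrome W.
Proof.
have := pal_sum (leq0n _); rewrite subn0 pal_complexity0 pal_complexity_size.
by case: palindrome.
Qed.

Let palW := pal_sum_palindrome.

Lemma pal_sum_rich : size W < \sum_(n < (size W).+1) pal_complexity W n.
Proof.
suff : \sum_(n < (size W).+1) pal_complexity W n +
       \sum_(n < (size W).+1) pal_complexity W n = (size W).+1 * 2.
  by set S := bigop _ _ _ => ?; lia.
rewrite {2}(reindex_inj rev_ord_inj) /= -big_split /=.
rewrite (eq_bigr (fun=> 2)) => [|i _]; first by rewrite sum_nat_const card_ord.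
by rewrite subSS pal_sum // -ltnS.
Qed.

(** In the equalities at [n] and [size W - n.+1], the four palindrome counts form two pairs of sum
    2. *)
Lemma pal_sum_branching n : n < size W ->
  branching W n + branching W (size W - n.+1) = (K <= n) + (K <= size W - n.+1).
Proof.
move=> lt_n; have step := pal_complexity_step palW pal_sum_rich.
have := step _ lt_n; have := step (size W - n.+1) ltac:(lia).
rewrite (_ : (size W - n.+1).+1 = size W - n); last by lia.
by have := pal_sum (ltnW lt_n); have := pal_sum lt_n; lia.
Qed.

(* The prefix of length K, being the reversal of the shortest unrepeated
   suffix, occurs only once. *)
Lemma unrepeated_prefix j : j + K <= size W -> block W j K = block W 0 K -> j = 0.
Proof.
move=> le_j jE; apply/eqP/negPn/negP => j0.
have le_K := shortest_unrepeated_suffix_le W.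
have := shortest_unrepeated_suffix_leE le_K; rewrite leqnn unrepeated_suffixE //.
move/esym/hasPn/(_ (size W - K - j)); rewrite mem_iota => /(_ ltac:(lia))/eqP; apply.
have rev_block i : i + K <= size W -> block W (size W - K - i) K = rev (block W i K).
  move=> le_i; have [x0 _] : exists x0, x0 \in W.
    by case: (W) le_j j0 => [|x s _ _]; [rewrite leqn0; lia | exists x; rewrite mem_head].
  apply: (@eq_from_nth _ x0) => [|q]; first by rewrite size_rev !size_block; lia.
  rewrite size_block; last by lia.
  move=> lt_q; rewrite nth_rev size_block ?nth_block; try lia.
  by rewrite -(nth_pal x0 palW); [congr nth; lia | lia].
rewrite rev_block // jE -rev_block; last by lia.
by rewrite subn0 /block take_oversize // size_drop; lia.
Qed.

(** If R + K < N, then s(K) = 2, and some palindrome [r] of length K - 1 occurs with all four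
    choices of neighbouring letters. From the first occurrence of [r] a second occurrence of the
    prefix of length K is deduced, against [unrepeated_prefix]. *)
Lemma pal_sum_trapezoidal : trapezoidal W.
Proof.
have le_RK := bound_add_suffix_le W; rewrite /trapezoidal.
case: (ltngtP (R + K) (size W)) le_RK => // lt_RK _; exfalso.
have bE n : (0 < branching W n) = (n < R) := branching_gt0 W n.
have K_gt0 : 0 < K.
  rewrite lt0n; apply/eqP => K0.
  have := @unrepeated_prefix 1; by rewrite K0 /block !take0 => /(_ ltac:(lia) erefl).
have b0 : branching W 0 <= 1.
  have := @pal_sum_branching 0 ltac:(lia); lia.
(* In [pal_sum_branching] at [K] the second term vanishes, because [size W - K.+1] is at least
   [R]. *)
have [lt_KR bK] : K < R /\ branching W K = 2.
  have := @pal_sum_branching K ltac:(lia).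
  have := bE K; have := bE (size W - K.+1); lia.
have bK1 : branching W K.-1 <= 1.
  have := @pal_sum_branching K.-1 ltac:(lia).
  have := bE (size W - K.-1.+1); lia.
have ext_le2 u : extensions W u <= 2.
  apply: leq_trans (count_size _ _) _; move: b0; rewrite branching0; lia.
(* Over two letters each right special factor counts for exactly 1, so there are two of length
   [K]. *)
pose S := [seq u <- factors W K | right_special W u].
have size_S : size S = 2.
  rewrite size_filter -sum1_count big_mkcond -bK; apply: eq_bigr => u _.
  by rewrite right_special_extensions; have := ext_le2 u; case: ltnP; lia.
have [p [q [pS qS pq]]] : exists p q, [/\ p \in S, q \in S & p != q].
  have := filter_uniq (right_special W) (factors_uniq W K); rewrite -/S.
  case: (S) size_S => [|p [|q s]] // _; rewrite /= inE negb_or -andbA.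
  by case/andP=> pq _; exists p, q; rewrite !inE !eqxx orbT.
have [x [r [sr RSx]]] : exists y r, size r = K.-1 /\ right_special W (y :: r).
  move: pS; rewrite mem_filter mem_factors => /and3P[RSp _ /eqP].
  by case: (p) RSp => [|y r RSp] /=; [lia | exists y, r; split=> //; lia].
have RSr : right_special W r := @right_special_catr _ W [:: x] r RSx.
clear x RSx.
have uniq_r v : size v = K.-1 -> right_special W v -> v = r.
  by move=> sv RSv; apply: (branching_le1_unique bK1).
have [a [b [ab RSa RSb]]] : exists a b,
    [/\ a <> b, right_special W (a :: r) & right_special W (b :: r)].
  have S_cons v : v \in S -> exists2 z, v = z :: r & right_special W (z :: r).
    rewrite mem_filter mem_factors => /and3P[RSv _ /eqP].
    case: v RSv => [|z v] RSv /= sv; first by clear -sv K_gt0; lia.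
    exists z; first by congr cons; apply: uniq_r (@right_special_catr _ W [:: z] v RSv); rewrite -sv.
    by rewrite -(uniq_r v) ?(@right_special_catr _ W [:: z] v RSv) // -sv.
  have [[a pE RSa] [b qE RSb]] := (S_cons p pS, S_cons q qS).
  by exists a, b; split=> // ab; rewrite pE qE ab eqxx in pq.
have infix_r x : right_special W (x :: r) -> infix (x :: r) W.
  by move/right_special_factor; rewrite mem_factors => /andP[].
have two_letters x : x \in W -> x = a \/ x = b.
  have two : size (undup W) <= 2 by move: b0; rewrite branching0; lia.
  have sub : {subset [:: a; b] <= undup W}.
    move=> z; rewrite mem_undup !inE => /orP[] /eqP->.
      by apply: (mem_infix (infix_r _ RSa)); rewrite mem_head.
    by apply: (mem_infix (infix_r _ RSb)); rewrite mem_head.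
  have uniq_ab : uniq [:: a; b] by rewrite /= inE andbT; apply/eqP.
  have [_ eq_ab] := uniq_min_size uniq_ab sub two.
  rewrite -mem_undup -eq_ab !inE => /orP[] /eqP->; by [left | right].
have RSx x : x \in W -> right_special W (x :: r) by case/two_letters=> ->.
have all_ext x y : x \in W -> y \in W -> infix (rcons (x :: r) y) W.
  move=> xW yW; have /right_specialP[c [d [cd xc xd]]] := RSx x xW.
  move: (two_letters _ (infix_rcons_mem xc)) (two_letters _ (infix_rcons_mem xd)).
  move: (two_letters _ yW).
  by case=> ->; case=> cE; case=> dE; rewrite cE in xc cd; rewrite dE in xd cd.
have pal_r : rev r = r.
  apply: uniq_r; first by rewrite size_rev.
  apply/right_specialP; exists a, b; split=> //.
    by rewrite -rev_cons infix_pal ?infix_r.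
  by rewrite -rev_cons infix_pal ?infix_r.
have rW : infix r W.
  by have := right_special_factor RSr; rewrite mem_factors => /andP[].
have [x0 _] : exists x0, x0 \in W.
  by exists a; apply: (mem_infix (infix_r _ RSa)); rewrite mem_head.
have leK := shortest_unrepeated_suffix_le W.
(* Two occurrences of x r, one of them ending in the first occurrence of r,
   are preceded by the same letters as long as r does not reappear. *)
have ex_r : exists i, (i + K.-1 <= size W) && (block W i K.-1 == r).
  by case/infix_blockP: rW => i le_i rE; exists i; rewrite -sr le_i -rE eqxx.
case: (ex_minnP ex_r) => -[|i] /andP[le_i /eqP iE] min_i.
  (* If [r] is a prefix, followed by [y], the factor [a r y] contains the prefix [r y] at a positive
     position. *)
  pose y := nth x0 W K.-1.
  have ry : block W 0 K = rcons r y.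
    by rewrite -{1}(prednK K_gt0) (block_rcons x0) ?iE //; clear -K_gt0 leK; lia.
  have : infix (rcons (a :: r) y) W.
    by apply: all_ext; [apply: (mem_infix (infix_r _ RSa)); rewrite mem_head
      | apply: mem_nth; clear -leK K_gt0; lia].
  case/infix_blockP=> j; rewrite /= size_rcons sr => le_j.
  rewrite (block_cons x0); last by clear -le_j; lia.
  case=> _ jE; have := @unrepeated_prefix j.+1.
  by rewrite ry jE prednK // => /(_ ltac:(clear -le_j; lia) erefl).
(* Otherwise the first [r] starts at [i.+1]. The word of length [K] at [i] is right special, so it
   occurs elsewhere, and necessarily later. *)
have [j [lt_ij le_j jE]] : exists j, [/\ i < j, j + K <= size W &
    block W j K = block W i K].
  have xr : block W i K = nth x0 W i :: r.
    by rewrite -[in LHS](prednK K_gt0) (block_cons x0) ?iE //; clear -le_i; lia.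
  have /right_specialP[c [d [cd xc xd]]] : right_special W (nth x0 W i :: r).
    by apply/RSx/mem_nth; clear -le_i; lia.
  have occ z : infix (rcons (nth x0 W i :: r) z) W -> exists2 j, j + K < size W &
      block W j K = block W i K /\ nth x0 W (j + K) = z.
    case/infix_blockP=> j; rewrite size_rcons /= sr prednK // => le_j jE.
    exists j; first by rewrite -addnS.
    rewrite (block_rcons x0) -?addnS // in jE.
    by have [<- <-] := @rcons_inj _ (nth x0 W i :: r) _ _ _ jE; rewrite xr.
  have [[j le_j [jE jc]] [k le_k [kE kd]]] := (occ c xc, occ d xd).
  have later m : m + K < size W -> block W m K = block W i K -> m != i -> i < m.
    move=> le_m mE m_i; rewrite ltn_neqAle eq_sym m_i -ltnS; apply: min_i.
    apply/andP; split; first by clear -le_m K_gt0; lia.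
    move: mE; rewrite xr -[in LHS](prednK K_gt0) (block_cons x0); last by clear -le_m; lia.
    by case=> _ ->.
  have [ji|/(later _ le_j jE) lt_j] := eqVneq j i; last by exists j; split=> //; apply: ltnW.
  have [ki|/(later _ le_k kE) lt_k] := eqVneq k i; last by exists k; split=> //; apply: ltnW.
  by case: cd; rewrite -jc -kd ji ki.
clear p q pS qS pq.
have back k : k <= i -> block W (j - k) K = block W (i - k) K.
  elim: k => [|k IH] lt_k; first by rewrite !subn0.
  have {IH} := IH (ltnW lt_k); set p := j - k.+1; set q := i - k.+1.
  have [-> ->] : j - k = p.+1 /\ i - k = q.+1 by rewrite /p /q; clear -lt_k lt_ij; lia.
  have [lt_p lt_q] : p + K < size W /\ q + K < size W.
    by rewrite /p /q; clear -lt_k lt_ij le_j K_gt0; lia.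
  rewrite -(prednK K_gt0) => eqS.
  have eq_pq : block W p.+1 K.-1 = block W q.+1 K.-1.
    have tkE m : block W m K.-1 = take K.-1 (block W m K.-1.+1).
      by rewrite /block take_takel.
    by rewrite tkE eqS -tkE.
  have pW : infix (block W p K.-1.+1) W := block_infix _ _ _.
  have qW : infix (block W q K.-1.+1) W := block_infix _ _ _.
  move: pW qW; rewrite !(block_cons x0) ?eq_pq; try by clear -lt_p lt_q; lia.
  move=> pW qW; have [-> // | /eqP neq] := eqVneq (nth x0 W p) (nth x0 W q).
  (* Different preceding letters would make the reversed block right special, hence equal to [r], at
     a position before the first [r]. *)
  have sB : size (block W q.+1 K.-1) = K.-1.
    by rewrite size_block //; clear -lt_q K_gt0; lia.
  have : rev (block W q.+1 K.-1) = r.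
    apply: uniq_r; first by rewrite size_rev.
    apply/right_specialP; exists (nth x0 W p), (nth x0 W q).
    by split=> //; rewrite -rev_cons infix_pal.
  rewrite -pal_r => /(can_inj revK) Br.
  have := min_i q.+1; rewrite Br eqxx andbT.
  by move=> /(_ ltac:(clear -lt_q K_gt0; lia)); rewrite /q; clear -lt_k; lia.
have := back i (leqnn i); rewrite subnn => /unrepeated_prefix.
by move=> /(_ ltac:(clear -le_j; lia)); clear -lt_ij; lia.
Qed.
End FromPalindromeCounts.

(** * Sturmian words *)

Section InfiniteFactors.
Variables (T : eqType) (X : nat -> T).
Implicit Types (u v : seq T) (i j n : nat).

Definition window i n := [seq X (i + j) | j <- iota 0 n].

Lemma window_cat i m n : window i (m + n) = window i m ++ window (i + m) n.
Proof.
rewrite /window iotaD map_cat add0n -[m in iota m n]addn0 iotaDl -map_comp.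
by congr (_ ++ _); apply: eq_map => j /=; rewrite addnA.
Qed.

Lemma window_rcons i n : window i n.+1 = rcons (window i n) (X (i + n)).
Proof. by rewrite -addn1 window_cat -cats1 {2}/window /= addn0. Qed.

Lemma size_window i n : size (window i n) = n.
Proof. by rewrite size_map size_iota. Qed.

Lemma window_factor i n : infinite_factor (window i n) X.
Proof. by exists i; rewrite size_window. Qed.

Lemma infinite_factor_infix u v :
  infix u v -> infinite_factor v X -> infinite_factor u X.
Proof.
case/infixP=> p [s ->] [i]; rewrite !size_cat -/(window _ _) !window_cat => /eqP.
rewrite eqseq_cat ?size_window // => /andP[_].
by rewrite eqseq_cat ?size_window // => /andP[/eqP-> _]; apply: window_factor.
Qed.

Lemma infinite_factor_rcons u :
  infinite_factor u X -> exists x, infinite_factor (rcons u x) X.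
Proof.
case=> i uE; exists (X (i + size u)); rewrite {1}uE -/(window _ _).
by rewrite -window_rcons; apply: window_factor.
Qed.

Lemma rcons_choice n (s : seq (seq T)) :
  (forall u, u \in s -> size u = n /\ infinite_factor u X) ->
  exists s', [/\ map (take n) s' = s
    & forall v, v \in s' -> size v = n.+1 /\ infinite_factor v X].
Proof.
elim: s => [|u s IH] sX; first by exists [::].
have [|s' [s'E s'X]] := IH; first by move=> v vs; apply: sX; rewrite inE vs orbT.
have [su uX] := sX u (mem_head _ _).
have [x uxX] := infinite_factor_rcons uX.
exists (rcons u x :: s'); split=> [|v]; first by rewrite /= s'E -su -cats1 take_size_cat.
by rewrite inE => /orP[/eqP->|/s'X //]; rewrite size_rcons su.
Qed.

End InfiniteFactors.

Lemma infinite_factor_map (T U : eqType) (g : T -> U) (X : nat -> T) (u : seq T) :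
  infinite_factor u X -> infinite_factor (map g u) (fun j => g (X j)).
Proof. by case=> i uE; exists i; rewrite size_map {1}uE -map_comp. Qed.

(** * Branching in factors of Sturmian words *)

Section SturmianTrapezoidal.
Variables (T T' : eqType) (f : T -> T') (X : nat -> T') (W : seq T).
Hypothesis f_inj : injective f.
Hypothesis sturmX : sturmian_infinite X.
Hypothesis WX : infinite_factor (map f W) X.

Lemma map_infix (U V : eqType) (g : U -> V) (s t : seq U) :
  infix s t -> infix (map g s) (map g t).
Proof.
by case/infixP=> p [q ->]; rewrite !map_cat; apply: infix_infix.
Qed.

Lemma uniq_map_inj (U V : eqType) (g : U -> V) (s : seq U) :
  uniq (map g s) -> {in s &, injective g}.
Proof.
elim: s => //= x s IH /andP[gx uniq_s] y z; rewrite !inE.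
case/orP=> [/eqP->|ys]; case/orP=> [/eqP->|zs] // gyz; last exact: IH.
  by rewrite gyz map_f in gx.
by rewrite -gyz map_f in gx.
Qed.

(* At most one factor of length n.+1 of W avoids a list that extends every
   factor of length n of X by a single letter. *)
Lemma sturmian_branching_le1 n : branching W n <= 1.
Proof.
have [s [uniq_s size_s sP]] := sturmX n.
have [t [uniq_t size_t tP]] := sturmX n.+1.
have [s' [s'E s'X]] := rcons_choice (fun u => (sP u).1).
have uniq_s' : uniq s' by apply: (@map_uniq _ _ (take n)); rewrite s'E.
have size_s' : size s' = n.+1 by rewrite -size_s -s'E size_map.
pose A := map (map f) (factors W n.+1).
have uniq_A : uniq A by rewrite map_inj_uniq ?factors_uniq //; apply: inj_map.
have At v : v \in A -> v \in t.
  case/mapP=> u; rewrite mem_factors => /andP[uW /eqP su] ->; apply/tP.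
  by rewrite size_map su; split=> //; apply: infinite_factor_infix WX; exact: map_infix.
(* [s'] contains [n + 1] of the [n + 2] words of [t]. *)
have out : size [seq v <- A | v \notin s'] <= 1.
  have : size ([seq v <- A | v \notin s'] ++ s') <= size t.
    apply: uniq_leq_size => [|v].
      rewrite cat_uniq filter_uniq // uniq_s' andbT; apply/hasPn => v vs.
      by rewrite mem_filter vs.
    rewrite mem_cat mem_filter => /orP[/andP[_ /At] // | /s'X vX].
    exact/tP.
  by rewrite size_cat size_t size_s'; lia.
(* A word of [s'] is determined by its prefix of length [n]; for a word of [A] this prefix is the
   image of a factor that has an extension. *)
have inn : size [seq v <- A | v \in s'] <= count (fun u => 0 < extensions W u) (factors W n).
  rewrite -(size_map (take n)) -size_filter -(size_map (map f)).
  apply: uniq_leq_size.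
    rewrite map_inj_in_uniq ?filter_uniq // => v w.
    rewrite !mem_filter => /andP[vs _] /andP[ws _] vw.
    by apply: (@uniq_map_inj _ _ (take n) s'); rewrite ?s'E.
  move=> v /mapP[w]; rewrite mem_filter => /andP[_ /mapP[u]].
  rewrite mem_factors => /andP[uW /eqP su] -> ->; rewrite -map_take; apply: map_f.
  case/lastP: u su uW => // u x; rewrite size_rcons => -[su] uxW.
  rewrite -cats1 take_size_cat // mem_filter mem_factors su eqxx andbT.
  rewrite (infix_trans (infix_rcons u x) uxW) andbT.
  by apply/extensions_gt0P; exists x.
have : size A = size [seq v <- A | v \notin s'] + size [seq v <- A | v \in s'].
  by rewrite !size_filter addnC count_predC.
rewrite size_map size_factorsS.
have -> : \sum_(u <- factors W n) extensions W u =
    branching W n + count (fun u => 0 < extensions W u) (factors W n).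
  rewrite -sum1_count [X in _ + X]big_mkcond /branching -big_split /=.
  by apply: eq_bigr => u _; case: (extensions W u) => //= m; rewrite addn1.
by move: out inn; lia.
Qed.

End SturmianTrapezoidal.

(** * The substitution 0 -> 0, 1 -> 01 *)

Section Substitution.
Implicit Types (u v w : seq bool) (X Y : nat -> bool) (i j k n : nat).

(* The letters 0 and 1 are false and true. *)
Definition subst w := flatten [seq if x then [:: false; true] else [:: false] | x <- w].

(** The recursion removes the image of [X 0], of length 2 or 1. Position 0 needs no case, since both
    images begin with 0. *)
Fixpoint substi X i : bool :=
  if i is i1.+1 then
    if X 0 then (if i1 is i2.+1 then substi (fun j => X j.+1) i2 else true)
    else substi (fun j => X j.+1) i1
  else false.

Lemma subst_cat u v : subst (u ++ v) = subst u ++ subst v.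
Proof. by rewrite /subst map_cat flatten_cat. Qed.

Lemma subst_rcons u x :
  subst (rcons u x) = subst u ++ if x then [:: false; true] else [:: false].
Proof. by rewrite -cats1 subst_cat; case: x. Qed.

Lemma size_subst w : size (subst w) = size w + count id w.
Proof. by elim: w => //= -[] w IH; rewrite /subst /= -/(subst w) IH; lia. Qed.

Lemma count_subst w : count id (subst w) = count id w.
Proof. by elim: w => //= -[] w IH; rewrite /subst /= -/(subst w) IH. Qed.

(** The reversed images 0 and 10 are conjugate to 0 and 01 by the letter 0. This is why
    [rcons (subst w) false] is a palindrome only if [w] is. *)
Lemma rev_subst w : rcons (subst (rev w)) false = false :: rev (subst w).
Proof.
elim: w => //= x w IH; rewrite rev_cons subst_rcons -cats1 -catA.
have -> : subst (x :: w) = (if x then [:: false; true] else [:: false]) ++ subst w by [].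
rewrite rev_cat -cat_cons -IH -cats1 -catA; congr cat; by case: x {IH}.
Qed.

Lemma subst_inj : injective subst.
Proof.
elim=> [|x u IH] [|y v] //=; try by [case: x | case: y].
have subst_true s t : subst s <> true :: t by case: s => [|[]].
case: x; case: y; rewrite /subst /= -/(subst u) -/(subst v).
- by case=> /IH->.
- by case=> /esym/subst_true.
- by case=> /subst_true.
by case=> /IH->.
Qed.

(** Cut before each 0: without 11 the pieces are 0 and 01, and the last one is 0. *)
Lemma subst_surj v : ~~ infix [:: true; true] v -> head false v = false ->
  last false v = false -> v <> [::] -> exists w, v = rcons (subst w) false.
Proof.
have [m] := ubnP (size v); elim: m v => // m IH [|[] v] //= lt_m no11 _ lastv _.
have no11' : ~~ infix [:: true; true] v.
  by apply: contra no11; apply: (@infix_catl _ _ _ [:: false]).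
case: v lt_m no11 lastv no11' => [|[] v] lt_m no11 lastv no11'; first by exists [::].
  case: v lt_m {no11} lastv no11' => [|[] v] // lt_m lastv no11'.
    by move: no11'; rewrite /= prefix0s.
  have no11 : ~~ infix [:: true; true] (false :: v).
    by apply: contra no11'; apply: (@infix_catl _ _ _ [:: true]).
  have [|w wE] := IH (false :: v) _ no11 erefl lastv ltac:(by []).
    by move: lt_m => /=; lia.
  by exists (true :: w); rewrite /subst /= -/(subst w) wE.
have [|w wE] := IH (false :: v) _ no11' erefl lastv ltac:(by []).
  by move: lt_m => /=; lia.
by exists (false :: w); rewrite /subst /= -/(subst w) wE.
Qed.

Fixpoint starts X u :=
  if u is x :: u' then (X 0 == x) && starts (fun j => X j.+1) u' else true.

Lemma eq_starts X Y u : X =1 Y -> starts X u = starts Y u.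
Proof.
by elim: u X Y => //= x u IH X Y eqXY; rewrite eqXY; congr andb; apply: IH.
Qed.

Lemma infinite_factorP u X :
  infinite_factor u X <-> exists i, starts (fun j => X (i + j)) u.
Proof.
have startsE i : u = window X i (size u) <-> starts (fun j => X (i + j)) u.
  elim: u i => //= x u IH i; rewrite /window /= -/(window X i _) addn0.
  have -> : [seq X (i + j) | j <- iota 1 (size u)] = window X i.+1 (size u).
    by rewrite (iotaDl 1 0) -map_comp; apply: eq_map => j /=; rewrite addnS.
  have -> : starts (fun j => X (i + j.+1)) u = starts (fun j => X (i.+1 + j)) u.
    by apply: eq_starts => j; rewrite addnS.
  split; first by case=> -> /IH ->; rewrite eqxx.
  by case/andP=> /eqP-> /IH <-.
by split=> -[i /startsE]; exists i.
Qed.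

Lemma eq_infinite_factor X Y u : X =1 Y -> infinite_factor u X -> infinite_factor u Y.
Proof. by move=> eqXY [i ->]; exists i; rewrite size_map size_iota; apply: eq_map. Qed.

(** The final 0, with which the next image begins in any case, keeps a last 0 of [subst u] from
    being the start of 01. *)
Lemma starts_substi X u : starts (substi X) (rcons (subst u) false) = starts X u.
Proof.
elim: u X => // x u IH X; case: x; rewrite /subst /= -/(subst u); case X0: (X 0) => //=.
by case: (u) => [|[] v].
Qed.

Lemma substi_shift X k : exists i, forall j, substi X (i + j) = substi (fun m => X (k + m)) j.
Proof.
elim: k X => [|k IH] X; first by exists 0.
have [i iE] := IH (fun m => X m.+1).
by exists (if X 0 then i.+2 else i.+1) => j; rewrite -[RHS]iE; case X0: (X 0); rewrite /= X0.
Qed.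

(** Each image has its only 0 in front, so every 0 starts the image of a letter. *)
Lemma substi_block X i : substi X i = false ->
  exists k, forall j, substi X (i + j) = substi (fun m => X (k + m)) j.
Proof.
have [n] := ubnP i; elim: n i X => // n IH [|i] X lt_n; first by exists 0.
rewrite /=; case X0: (X 0); last first.
  by case/IH=> [|k kE]; [lia | exists k.+1 => j; rewrite -kE].
case: i lt_n => // i lt_n.
by case/IH=> [|k kE]; [lia | exists k.+1 => j; rewrite -kE].
Qed.

Lemma substi_true X i : substi X i -> i != 0 /\ substi X i.-1 = false /\ substi X i.+1 = false.
Proof.
have [n] := ubnP i; elim: n i X => // n IH [|i] X lt_n //.
rewrite [substi X i.+1]/=; case X0: (X 0); last first.
  move=> /[dup] Yi /IH[|i0 [p s]]; first by lia.
  by split=> //; rewrite [i.+1.-1]/=; case: i i0 p s Yi lt_n => //= i; rewrite X0.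
case: i lt_n => [|i] lt_n; first by rewrite /= X0.
move=> /[dup] Yi /IH[|i0 [p s]]; first by lia.
by split=> //; case: i i0 p s Yi lt_n => //= i; rewrite X0.
Qed.

Lemma infinite_factor_subst X u :
  infinite_factor (rcons (subst u) false) (substi X) <-> infinite_factor u X.
Proof.
rewrite !infinite_factorP; split=> [[i si]|[k sk]].
  have i0 : substi X i = false.
    by move: si; case: (u) => [|[] v] /= /andP[/eqP]; rewrite addn0.
  have [k kE] := substi_block i0; exists k; rewrite -starts_substi.
  by rewrite -(eq_starts _ kE).
have [i iE] := substi_shift X k; exists i.
by rewrite (eq_starts _ iE) starts_substi.
Qed.

Lemma substi_no11 X u : infinite_factor u (substi X) -> ~~ infix [:: true; true] u.
Proof.
move=> uX; apply/negP => u11; have := infinite_factor_infix u11 uX.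
case/infinite_factorP=> i /=; rewrite addn0 addn1 => /and3P[/eqP Xi /eqP Xi1 _].
by have [_ [_]] := substi_true Xi; rewrite Xi1.
Qed.

Lemma substi_true_rcons X u : infinite_factor (rcons u true) (substi X) ->
  infinite_factor (rcons (rcons u true) false) (substi X).
Proof.
move=> uX; have [[] // uX'] := infinite_factor_rcons uX.
case/negP: (substi_no11 uX'); rewrite -!cats1 -catA; exact: suffix_infix.
Qed.

Lemma substi_true_cons X u : infinite_factor (true :: u) (substi X) ->
  infinite_factor (false :: true :: u) (substi X).
Proof.
case/infinite_factorP=> i /= /andP[]; rewrite addn0 => /eqP Xi si.
have [i0 [p _]] := substi_true Xi; apply/infinite_factorP; exists i.-1.
have E j : i.-1 + j.+1 = i + j by lia.
rewrite /= addn0 p /= E addn0 Xi /=; apply: etrans si; apply: eq_starts => j.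
by rewrite E.
Qed.

(** * Right special factors of binary infinite words *)

Definition special X u := forall x, infinite_factor (rcons u x) X.

Lemma special_catr X p u : special X (p ++ u) -> special X u.
Proof.
by move=> pu x; apply: infinite_factor_infix (pu x); rewrite rcons_cat suffix_infix.
Qed.

Lemma special_subst X u : special X u -> special (substi X) (rcons (subst u) false).
Proof.
move=> Su [].
  have /infinite_factor_subst := Su true; rewrite subst_rcons.
  by apply: infinite_factor_infix; rewrite -cats1 -!cats1 -catA catA prefix_infix.
have /infinite_factor_subst := Su false; rewrite subst_rcons.
by rewrite cats1.
Qed.

(** A special [v] ends in 0, since 11 does not occur, and a leading 1 is always preceded by 0;
    completed by this 0 if needed, [v] has the form [rcons (subst u) false]. *)
Lemma special_substP X v : special (substi X) v -> v <> [::] ->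
  exists u, [/\ special X u, size u < size v & suffix v (rcons (subst u) false)].
Proof.
move=> Sv v0; have lastv : last false v = false.
  case/lastP: v Sv v0 => // v [] Sv _; rewrite last_rcons //.
  case/negP: (substi_no11 (Sv true)); rewrite -!cats1 -catA; exact: suffix_infix.
pose v1 := if head false v then false :: v else v.
have Sv1 : special (substi X) v1.
  rewrite /v1; clear v1; case: v Sv v0 lastv => // -[] v Sv _ _ //= x.
  exact: substi_true_cons (Sv x).
have no11 : ~~ infix [:: true; true] v1.
  apply: contra (substi_no11 (Sv1 true)) => /infix_trans; apply; exact: infix_rcons.
have [u uE] : exists u, v1 = rcons (subst u) false.
  apply: subst_surj => //; rewrite /v1; by case: (v) v0 lastv => // -[].
exists u; split.
- case; last first.
    by apply/infinite_factor_subst; rewrite subst_rcons cats1 -uE; apply: Sv1.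
  apply/infinite_factor_subst; rewrite subst_rcons.
  have := substi_true_rcons (Sv1 true).
  by rewrite uE -!cats1 -!catA.
(* If a 0 was prepended, its length is made up for by a letter 1 of [u], whose image has length
   2. *)
- have : size v1 = size u + count id u + 1 by rewrite uE size_rcons size_subst addn1.
  move: uE; rewrite /v1; clear; case: v => [|[] v] /= uE; [by lia | | by lia].
  have : count id u != 0.
    by have := congr1 (count id) uE; rewrite -cats1 count_cat count_subst /=; lia.
  lia.
rewrite -uE /v1; case: (v) => // -[] v2 /=; [exact: suffix_cons | exact: suffix_refl].
Qed.

(** The bound [n] supports an induction for [fibonacci]: each passage through [substi] raises it by
    1. *)
Definition special_unique_below n X := forall u v,
  special X u -> special X v -> size u = size v -> size u < n -> u = v.

(** By uniqueness below [n], the shorter of the two preimages is a suffix of the longer one, so both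
    words are suffixes of a single word. *)
Lemma special_unique_substi n X :
  special_unique_below n X -> special_unique_below n.+1 (substi X).
Proof.
move=> uniqX v1 v2 S1 S2 sv lt_n.
have [v10|v10] := eqVneq v1 [::].
  by rewrite v10 in sv *; apply/esym/size0nil; rewrite -sv.
have v20 : v2 != [::] by rewrite -size_eq0 -sv size_eq0.
have [u1 [Su1 lt_u1 suf1]] := special_substP S1 (elimN eqP v10).
have [u2 [Su2 lt_u2 suf2]] := special_substP S2 (elimN eqP v20).
wlog le_u : v1 v2 S1 S2 sv lt_n {v10 v20} u1 u2 Su1 Su2 lt_u1 lt_u2 suf1 suf2 /
    size u1 <= size u2.
  move=> H; case: (leqP (size u1) (size u2)) => [le_u|/ltnW le_u]; first exact: (H v1 v2 _ _ _ _ u1 u2).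
  by apply/esym; apply: (H v2 v1 _ _ _ _ u2 u1) => //; rewrite -sv.
have u1E : u1 = drop (size u2 - size u1) u2.
  apply: uniqX => //; last by lia.
    by apply: (@special_catr X (take (size u2 - size u1) u2)); rewrite cat_take_drop.
  by rewrite size_drop; lia.
have suf : suffix (rcons (subst u1) false) (rcons (subst u2) false).
  rewrite -(cat_take_drop (size u2 - size u1) u2) -u1E subst_cat rcons_cat.
  exact: suffix_suffix.
move: (suffix_trans suf1 suf) suf2; rewrite !suffixE sv => /eqP-> /eqP<- //.
Qed.

Lemma special_negb X u : special X u -> special (fun j => ~~ X j) (map negb u).
Proof.
move=> Su x; have -> : rcons (map negb u) x = map negb (rcons u (~~ x)).
  by rewrite map_rcons negbK.
exact: infinite_factor_map (Su (~~ x)).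
Qed.

Lemma special_negbK X u : special (fun j => ~~ X j) u -> special X (map negb u).
Proof.
move=> /special_negb Su x.
by apply: eq_infinite_factor (Su x) => j; rewrite negbK.
Qed.

Lemma special_unique_negb n X :
  special_unique_below n X -> special_unique_below n (fun j => ~~ X j).
Proof.
move=> uniqX u v /special_negbK Su /special_negbK Sv suv lt_n.
by apply: (inj_map negb_inj); apply: uniqX => //; rewrite !size_map.
Qed.

Lemma eq_special X Y u : X =1 Y -> special X u -> special Y u.
Proof. by move=> eqXY Su x; apply: eq_infinite_factor (Su x). Qed.

(** Since the image always begins with 0, [n] letters of [X] determine [n + 1] letters of the image;
    this gain makes the approximations of [fibonacci] stabilise. *)
Lemma eq_substi X Y n j :
  (forall i, i < n -> X i = Y i) -> j <= n -> substi X j = substi Y j.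
Proof.
have [m] := ubnP j; elim: m n j X Y => // m IH n [|j] X Y lt_m eqXY le_j //=.
rewrite eqXY; last by lia.
have eqS i : i < n.-1 -> X i.+1 = Y i.+1 by move=> lt_i; apply: eqXY; lia.
case: (Y 0); last by apply: (IH n.-1) => //; lia.
by case: j lt_m le_j => // j lt_m le_j; apply: (IH n.-1) => //; lia.
Qed.

(** * The Fibonacci word *)

Fixpoint fibonacci_approx n : nat -> bool :=
  if n is m.+1 then substi (fun j => ~~ fibonacci_approx m j) else fun=> false.

(* The fixed point of 0 -> 01, 1 -> 0. *)
Definition fibonacci j := fibonacci_approx j.+1 j.

Lemma fibonacci_approxE n j : j < n -> fibonacci_approx n j = fibonacci j.
Proof.
have stable m i : i < m -> fibonacci_approx m.+1 i = fibonacci_approx m i.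
  elim: m i => // m IH i lt_i; apply: (@eq_substi _ _ m) => // k lt_k.
  by congr negb; apply: IH.
move=> /subnKC <-; elim: (n - _) => [|m IH]; first by rewrite addn0.
by rewrite addnS stable ?IH // leq_addr.
Qed.

Lemma fibonacciE : substi (fun j => ~~ fibonacci j) =1 fibonacci.
Proof.
move=> j; apply: (@eq_substi _ _ j) => // i lt_i.
by congr negb; apply: esym (fibonacci_approxE lt_i).
Qed.

(** Suffixes of special words are special, so this amounts to exactly one special factor of each
    length. *)
Definition uniquely_special X :=
  (forall n, exists2 u, special X u & n <= size u) /\
  (forall n, special_unique_below n X).

Lemma uniquely_special_negb X :
  uniquely_special X -> uniquely_special (fun j => ~~ X j).
Proof.
case=> exX uniqX; split=> n; last exact: special_unique_negb.
have [u Su le_n] := exX n; exists (map negb u); last by rewrite size_map.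
exact: special_negb.
Qed.

Lemma uniquely_special_substi X :
  uniquely_special X -> uniquely_special (substi X).
Proof.
case=> exX uniqX; split=> n.
  have [u Su le_n] := exX n; exists (rcons (subst u) false).
    exact: special_subst.
  by rewrite size_rcons size_subst; lia.
move=> u v Su Sv suv lt_n.
exact: (special_unique_substi (uniqX n) Su Sv suv (leqW lt_n)).
Qed.

Lemma uniquely_special_fibonacci : uniquely_special fibonacci.
Proof.
have specialS u : special fibonacci u ->
    special fibonacci (rcons (subst (map negb u)) false).
  by move=> /special_negb/special_subst; apply: eq_special fibonacciE.
split=> n.
  elim: n => [|n [u Su le_n]].
    exists [::] => // -[].
      by exists 1.
    by exists 0.
  exists (rcons (subst (map negb u)) false); first exact: specialS.
  by rewrite size_rcons size_subst size_map; lia.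
elim: n => [|n IH] //; have := special_unique_substi (special_unique_negb IH).
have fE : fibonacci =1 substi (fun j => ~~ fibonacci j) by move=> j; rewrite fibonacciE.
by move=> uniqF u v /(eq_special fE) Su /(eq_special fE) Sv; apply: uniqF.
Qed.

(** Among [n + 1] factors of length [n] one is special, with two extensions, and each other has
    exactly one; this gives [n + 2] factors of length [n + 1]. *)
Lemma uniquely_special_sturmian (U : eqType) (g : bool -> U) X :
  injective g -> uniquely_special X -> sturmian_infinite (fun j => g (X j)).
Proof.
move=> g_inj [exX uniqX].
suff H n : exists s, [/\ uniq s, size s = n.+1
    & forall u, u \in s <-> size u = n /\ infinite_factor u X].
  move=> n; have [s [uniq_s size_s sP]] := H n; exists (map (map g) s).
  split=> [||u]; rewrite ?map_inj_uniq ?size_map //; first exact: inj_map.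
  split=> [/mapP[v /sP[sv vX] ->]|[su [i uE]]].
    by rewrite size_map; split=> //; apply: infinite_factor_map.
  have uE' : u = map g (window X i n) by rewrite uE su -map_comp.
  rewrite uE'; apply/map_f/sP.
  by rewrite size_window; split=> //; apply: window_factor.
elim: n => [|n [s [uniq_s size_s sP]]].
  exists [:: [::]]; split=> // u; rewrite inE; split=> [/eqP->|[/size0nil->]] //.
  by split=> //; exists 0.
have [r [Sr sr]] : exists r, special X r /\ size r = n.
  have [u Su le_n] := exX n; exists (drop (size u - n) u).
  split; last by rewrite size_drop; lia.
  by apply: (@special_catr X (take (size u - n) u)); rewrite cat_take_drop.
have rs : r \in s.
  by apply/sP; split=> //; apply: infinite_factor_infix (Sr true); apply: infix_rcons.
have [t [uniq_t size_t tP]] : exists t, [/\ uniq t, size t = size (rem r s)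
    & forall w, w \in t <-> exists u x, [/\ u \in rem r s, w = rcons u x & infinite_factor w X]].
  have : forall u, u \in rem r s -> [/\ size u = n, infinite_factor u X & u <> r].
    by move=> u; rewrite mem_rem_uniq // => /andP[/eqP ur /sP[]].
  elim: (rem r s) (rem_uniq r uniq_s) => [_ _|u s' IH /= /andP[us' uniq_s'] uX].
    by exists [::]; split=> // w; split=> // -[u [x []]].
  have [|t [uniq_t size_t tP]] := IH uniq_s'.
    by move=> v vs'; apply: uX; rewrite inE vs' orbT.
  have [su uF ur] := uX u (mem_head _ _).
  have [x ux] := infinite_factor_rcons uF.
  (* A second extension would make [u] special, hence equal to [r]. *)
  have onlyx y : infinite_factor (rcons u y) X -> y = x.
    move=> uy; apply/eqP/negPn/negP => yx; apply: ur; apply: (uniqX n.+1) => //.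
    - by case; [case: (x) ux yx; case: (y) uy | case: (x) ux yx; case: (y) uy].
    - by rewrite su sr.
    by rewrite su.
  exists (rcons u x :: t); split=> [||w] /=.
  - rewrite uniq_t andbT; apply/negP => /tP[v [y [vs' /rcons_inj[uv _] _]]].
    by rewrite uv vs' in us'.
  - by rewrite size_t.
  rewrite inE; split=> [/orP[/eqP->|/tP[v [y [vs' -> vy]]]]|[v [y []]]].
  - by exists u, x; rewrite mem_head.
  - by exists v, y; rewrite inE vs' orbT.
  rewrite inE => /orP[/eqP-> -> /onlyx -> |vs' -> vy]; first by rewrite eqxx.
  by apply/orP; right; apply/tP; exists v, y.
exists [:: rcons r true, rcons r false & t]; split=> [||w] /=.
- rewrite uniq_t andbT inE negb_or (inj_eq (@rcons_injr _ r)) /=.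
  by apply/andP; split; apply/negP => /tP[u [x [us /rcons_inj[ru _] _]]];
    rewrite -ru mem_rem_uniq // inE eqxx in us.
- by rewrite size_t size_rem // size_s.
rewrite !inE; split=> [/or3P[/eqP->|/eqP->|/tP[u [x [us -> ux]]]]|[sw wX]].
- by rewrite size_rcons sr; split=> //; apply: Sr.
- by rewrite size_rcons sr; split=> //; apply: Sr.
- by move: us; rewrite mem_rem_uniq // size_rcons => /andP[_ /sP[-> _]].
case/lastP: w sw wX => // u x; rewrite size_rcons => -[su] ux.
have [-> | ur] := eqVneq u r; first by case: x {ux}; rewrite eqxx ?orbT.
apply/or3P/Or33/tP; exists u, x; split=> //; rewrite mem_rem_uniq // inE ur.
by apply/sP; split=> //; apply: infinite_factor_infix ux; apply: infix_rcons.
Qed.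

End Substitution.

(** * Desubstitution of binary palindromes *)

Section PalindromeEmbedding.
Implicit Types (u v w s t : seq bool).

(** Equivalently, 0t and 1t are never both right special in [V]. *)
Definition no_full_extension V :=
  forall t, ~ (forall x y : bool, infix (x :: rcons t y) V).

Lemma map_negbK : involutive (map negb).
Proof. by move=> s; rewrite -map_comp map_id_in // => x _ /=; rewrite negbK. Qed.

Lemma palindrome_map_negb V : palindrome V -> palindrome (map negb V).
Proof. by move/palP=> palV; apply/palP; rewrite -map_rev palV. Qed.

Lemma no_full_extension_negb V :
  no_full_extension V -> no_full_extension (map negb V).
Proof.
move=> noV t sq; apply: (noV (map negb t)) => x y.
by have := map_infix negb (sq (~~ x) (~~ y)); rewrite map_negbK /= map_rcons !negbK.
Qed.

Lemma infix_subst u v : infix u v -> infix (rcons (subst u) false) (rcons (subst v) false).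
Proof.
case/infixP=> p [s ->]; rewrite -!cats1 !subst_cat -!catA; apply: infix_catl.
apply/prefixW; rewrite prefix_catr // eqxx.
by case: s => [|[] s]; rewrite /subst /= ?prefix0s.
Qed.

Lemma subst_ends x : exists p, subst [:: x] = rcons p x.
Proof. by case: x; [exists [:: false] | exists [::]]. Qed.

Lemma subst_cons_rcons x t y :
  subst (x :: rcons t y) = subst [:: x] ++ subst t ++ subst [:: y].
Proof. by rewrite -!subst_cat cats1. Qed.

(** The image of [x] ends in [x], and the image of [y] followed by 0 begins with 0y. So all four
    extensions of [t] yield those of [rcons (subst t) false]. *)
Lemma infix_subst_ext x t y :
  infix (x :: rcons (rcons (subst t) false) y) (rcons (subst (x :: rcons t y)) false).
Proof.
have [p pE] := subst_ends x; rewrite subst_cons_rcons pE -!cats1 -!catA.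
apply/infix_catl/prefixW; rewrite /= eqxx prefix_catr // eqxx.
by case: y; rewrite /subst /= ?eqxx.
Qed.

Lemma palindrome_subst w : palindrome (rcons (subst w) false) -> palindrome w.
Proof.
move=> /palP; rewrite rev_rcons -rev_subst => /rcons_inj[/subst_inj rw].
exact/palP.
Qed.

(** If [V] has 0 at its ends, it is [rcons (subst w) false]. If it has 1 there, [false :: V] is
    [subst w], and [w] begins and ends with 1. *)
Lemma desubstitute V : palindrome V -> no_full_extension V ->
  ~~ infix [:: true; true] V -> V <> [::] -> V <> [:: true] ->
  exists w, [/\ size w < size V, palindrome w, no_full_extension w
    & infix V (rcons (subst w) false)].
Proof.
move=> palV noV no11 V0 V1.
have lastV : last false V = head false V.
  by rewrite -{2}(palP _ palV); case/lastP: (V) V0 => // s x _; rewrite last_rcons rev_rcons.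
case hV : (head false V); last first.
  have [w wE] := subst_surj no11 hV (etrans lastV hV) V0.
  exists w; split; last by rewrite wE infix_refl.
  - by rewrite wE size_rcons size_subst; lia.
  - by apply: palindrome_subst; rewrite -wE.
  move=> t sq; apply: (noV (rcons (subst t) false)) => x y; rewrite wE.
  exact: infix_trans (infix_subst_ext x t y) (infix_subst (sq x y)).
have no11' : ~~ infix [:: true; true] (rcons (false :: V) false).
  by rewrite infix_rconsl (suffix_rcons [:: true] _ true) /= no11.
have [w wE] := subst_surj no11' erefl (last_rcons _ _ _) ltac:(by []).
have {}wE : false :: V = subst w by have [] := rcons_inj wE.
have palw : palindrome w.
  by apply: palindrome_subst; rewrite -wE; apply/palP; rewrite rev_rcons rev_cons (palP _ palV).
(* The image exceeds [w] by its number of letters 1, here at least 2, while [V] received a single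
   0. *)
have lt_w : size w < size V.
  have : 1 < count id V.
    have : last false V = true by rewrite lastV hV.
    case: (V) V1 hV => // -[] // v V1 _; case/lastP: v V1 => // v x _ /=.
    by rewrite last_rcons => ->; rewrite -cats1 count_cat /= addn1.
  by have := size_subst w; have := count_subst w; rewrite -wE /=; lia.
have hw : head false w = true.
  case: (w) wE => // -[] // w1 [] VE; move: hV; rewrite VE.
  by case: (w1) => // -[].
have lw : last false w = true.
  by rewrite -hw -{1}(palP _ palw); case: (w) hw => // x w1 _; rewrite rev_cons last_rcons.
exists w; split=> //; last first.
  by rewrite -wE -cats1; apply: (@infix_infix _ [:: false] V [:: false]).
move=> t sq; apply: (noV (rcons (subst t) false)) => x y.
have /infixP[s1 [s2 w12]] := sq x y; have [p pE] := subst_ends x.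
(* The letter [x] found here is not the added 0, because [w] begins with 1. *)
have [p0 VE] : exists p0, V = p0 ++ x :: subst t ++ subst [:: y] ++ subst s2.
  have : false :: V = (subst s1 ++ p) ++ x :: subst t ++ subst [:: y] ++ subst s2.
    by rewrite wE w12 !subst_cat subst_cons_rcons pE -cats1 -!catA.
  case sp : (subst s1 ++ p) => [|z p0]; last by case=> _ ->; exists p0.
  case=> xE _; move: hw; rewrite w12; case: (s1) sp => [|[] s3] //= _.
  by rewrite -xE.
rewrite VE; apply/infix_catl/prefixW; rewrite /= eqxx -!cats1 -!catA prefix_catr // eqxx.
(* When [y] is 0, one more image must follow to supply 0y; it does, because [w] ends with 1. *)
case: y VE w12 => [|_ w12]; first by rewrite /subst /= ?prefix0s.
case: s2 w12 => [|[] s2] w12; try by rewrite /subst /= ?prefix0s.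
by move: lw; rewrite w12 cats0 last_cat /= last_rcons.
Qed.

Lemma infix_changes V : true \in V -> false \in V ->
  infix [:: true; false] V \/ infix [:: false; true] V.
Proof.
elim: V => // x [|y V] IH; first by rewrite !inE; case: x.
have [->|] := eqVneq x y.
  move=> tV fV; have [||H|H] := IH.
  - by move: tV; rewrite !inE orbA orbb.
  - by move: fV; rewrite !inE orbA orbb.
  - by left; apply: (@infix_catl _ _ _ [:: y]).
  by right; apply: (@infix_catl _ _ _ [:: y]).
by case: x; case: y {IH} => // _ _ _; [left | right]; rewrite /= prefix0s.
Qed.

(** If 00 and 11 both occur, so does 01 or 10, hence both by reversal, and the empty word has all
    four extensions. *)
Lemma no_full_extension_letters V : palindrome V -> no_full_extension V ->
  infix [:: true; true] V -> ~~ infix [:: false; false] V.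
Proof.
move=> palV noV V11; apply/negP => V00.
have [tV fV] : true \in V /\ false \in V.
  by split; [apply: (mem_infix V11) | apply: (mem_infix V00)].
have [V10 V01] : infix [:: true; false] V /\ infix [:: false; true] V.
  by have [H|H] := infix_changes tV fV; split=> //; rewrite -(infix_pal _ palV).
by apply: (noV [::]) => -[] [].
Qed.

(** Strong induction on the length: [desubstitute] shortens [V], after an exchange of letters if [V]
    contains 11 or is the word 1. *)
Lemma palindrome_uniquely_special V : palindrome V -> no_full_extension V ->
  exists2 X, uniquely_special X & infinite_factor V X.
Proof.
have [n] := ubnP (size V); elim: n V => // n IH V lt_n palV noV.
have [-> | /eqP V0] := eqVneq V [::].
  by exists fibonacci; [exact: uniquely_special_fibonacci | exists 0].
have step U : size U = size V -> palindrome U -> no_full_extension U ->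
    ~~ infix [:: true; true] U -> U <> [::] -> U <> [:: true] ->
    exists2 X, uniquely_special X & infinite_factor U X.
  move=> sU palU noU U11 U0 U1.
  have [w [lt_w palw now Uw]] := desubstitute palU noU U11 U0 U1.
  have [|X goodX wX] := IH w _ palw now; first by apply: leq_trans lt_w _; rewrite sU -ltnS.
  exists (substi X); first exact: uniquely_special_substi.
  by apply: infinite_factor_infix Uw _; apply/infinite_factor_subst.
have [V1|V1] := boolP ((V == [:: true]) || infix [:: true; true] V); last first.
  by move/norP: V1 => [/eqP V1 no11]; apply: step.
have no11 : ~~ infix [:: true; true] (map negb V).
  apply/negP => /(map_infix negb); rewrite map_negbK /=.
  case/orP: V1 => [/eqP-> //|V11]; apply/negP.
  exact: no_full_extension_letters.
have [||||||X goodX VX] := step (map negb V); rewrite ?size_map //.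
- exact: palindrome_map_negb.
- exact: no_full_extension_negb.
- by case: (V) V0.
- by move=> VE; move: V1; rewrite -[V]map_negbK VE.
exists (fun j => ~~ X j); first exact: uniquely_special_negb.
by rewrite -[V]map_negbK; apply: infinite_factor_map.
Qed.
End PalindromeEmbedding.

(** * Encoding over a two-letter alphabet *)

Section BinaryEncoding.
Variables (T : eqType) (W : seq T).
Hypothesis palW : palindrome W.
Hypothesis branching_le1 : forall n, branching W n <= 1.

(** The summand [bool] supplies the missing letters when [W] uses fewer than two. *)
Lemma binary_encoding : exists (h : T -> bool) (g : bool -> T + bool),
  injective g /\ {in W, forall x, g (h x) = inl x}.
Proof.
have := branching_le1 0; rewrite branching0.
have inW x : x \in W -> x \in undup W by rewrite mem_undup.
have := undup_uniq W; case: (undup W) inW => [|a [|b [|c s]]] //= inW ab _.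
- by exists xpredT, inr; split=> [x y [] // | x /inW].
- exists xpred0, (fun x : bool => if x then inr true else inl a); split=> [[] [] // | x].
  by move/inW; rewrite inE => /eqP->.
exists (pred1 b), (fun x : bool => if x then inl b else inl a).
move: ab; rewrite inE andbT => ab; split=> [[] [] // [] E | x /inW].
- by rewrite E eqxx in ab.
- by rewrite E eqxx in ab.
by rewrite !inE /= => /orP[] /eqP->; rewrite ?eqxx // (negbTE ab).
Qed.

Lemma infix_map_inv (U V : eqType) (h : U -> V) (p : seq V) (w : seq U) :
  infix p (map h w) -> exists2 u, infix u w & p = map h u.
Proof.
case/infix_blockP=> i _ ->; exists (block w i (size p)); first exact: block_infix.
by rewrite /block map_take map_drop.
Qed.

(** For both values of [x], the word [x :: t] would encode a right special factor of [W], against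
    uniqueness in each length. *)
Lemma no_full_extension_encoding (h : T -> bool) (g : bool -> T + bool) :
  {in W, forall x, g (h x) = inl x} -> no_full_extension (map h W).
Proof.
move=> gh t sq.
have inj_h u v : infix u W -> infix v W -> map h u = map h v -> u = v.
  have gmap w : infix w W -> map g (map h w) = map inl w.
    by move/mem_infix=> wW; rewrite -map_comp; apply/eq_in_map => x /wW/gh.
  move=> uW vW /(congr1 (map g)); rewrite !gmap //.
  by apply: inj_map => x y [].
have RS x : exists2 q, right_special W q & map h q = x :: t.
  have [u uW uE] := infix_map_inv (sq x true).
  have [v vW vE] := infix_map_inv (sq x false).
  case/lastP: u uW uE => // q y; rewrite map_rcons -rcons_cons => qW /rcons_inj[qE yE].
  case/lastP: v vW vE => // q' y'; rewrite map_rcons -rcons_cons => qW' /rcons_inj[qE' yE'].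
  have qq' : q = q'.
    apply: inj_h; last by rewrite -qE -qE'.
      exact: infix_trans (infix_rcons _ _) qW.
    exact: infix_trans (infix_rcons _ _) qW'.
  rewrite -qq' in qW'; exists q => //; apply/right_specialP; exists y, y'; split=> //.
  by move=> yy'; rewrite -yy' -yE in yE'.
have [q1 RS1 E1] := RS true; have [q2 RS2 E2] := RS false.
have [s1 s2] : size q1 = (size t).+1 /\ size q2 = (size t).+1.
  by rewrite -(size_map h q1) -(size_map h q2) E1 E2.
have q12 := branching_le1_unique (branching_le1 _) RS1 RS2 s1 s2.
by rewrite -q12 E1 in E2.
Qed.

Lemma trapezoidal_palindrome_sturmian : sturmian W.
Proof.
have [h [g [g_inj gh]]] := binary_encoding.
have palV : palindrome (map h W) by apply/palP; rewrite -map_rev (palP _ palW).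
have [X goodX VX] := palindrome_uniquely_special palV (no_full_extension_encoding gh).
exists (T + bool)%type, inl, (fun j => g (X j)); split.
- by move=> x y [].
- exact: uniquely_special_sturmian.
have -> : map inl W = map g (map h W).
  by rewrite -map_comp; apply/esym/eq_in_map.
exact: infinite_factor_map.
Qed.

End BinaryEncoding.

Theorem theorem2 (T : eqType) (W : seq T) (N : nat) (hN : size W = N) :
  ((sturmian W /\ palindrome W) <->
   (forall n : nat, n <= N ->
      pal_complexity W n + pal_complexity W (N - n) = 2)) /\
  ((forall n : nat, n <= N ->
      pal_complexity W n + pal_complexity W (N - n) = 2) <->
   (trapezoidal W /\ palindrome W)).
Proof.
subst N.
have sturmian_le1 : sturmian W -> forall n, branching W n <= 1.
  move=> [T' [f [X [f_inj sturmX WX]]]] n.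
  exact: sturmian_branching_le1 f_inj sturmX WX n.
have le1_counts : (forall n, branching W n <= 1) -> palindrome W -> forall n,
    n <= size W -> pal_complexity W n + pal_complexity W (size W - n) = 2.
  by move=> le1 palW n; apply: trapezoidal_pal_complexity.
have counts_pal := @pal_sum_palindrome _ W.
have counts_trap := @pal_sum_trapezoidal _ W.
have trap_le1 : trapezoidal W -> forall n, branching W n <= 1 by move/trapezoidalP.
split; split.
- by case=> /sturmian_le1.
- move=> counts; split; last exact: counts_pal.
  by apply: trapezoidal_palindrome_sturmian; [apply: counts_pal | apply/trap_le1/counts_trap].
- by move=> counts; split; [apply: counts_trap | apply: counts_pal].
by case=> /trap_le1.
Qed.
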